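(* Let $u_0\in L^\infty(\mathbb{R}^3;\mathbb{R}^3)$ be a divergence-free vector field satisfying $|u_0(x)|\to0$ as $|x|\to\infty$, and let $0<\nu_3\le\nu_2$ be fixed. For $\nu_1\ge\nu_2$ let $T^\star=T^\star(\nu_1)$ be the lifespan of the strong solution to $$\partial_t u-(\nu_1\partial_1^2+\nu_2\partial_2^2+\nu_3\partial_3^2)u+u\cdot\nabla u=-\nabla P,\qquad \operatorname{div}u=0,\qquad u|_{t=0}=u_0,\qquad (t,x)\in\mathbb{R}^+\times\mathbb{R}^3.$$ Then $$\lim_{\nu_1\to\infty}T^\star=\infty.$$
   Context: Here $u(t,x)\in\mathbb{R}^3$ is the velocity and $P$ the scalar pressure. A strong solution on $[0,T)$ with data $u_0\in L^\infty$ is a solution, belonging to $L^\infty([0,T'];L^\infty(\mathbb{R}^3))$ for all $T'<T$, of the integral equation $$u(t)=e^{t(\nu_1\partial_1^2+\nu_2\partial_2^2+\nu_3\partial_3^2)}u_0-\int_0^t e^{(t-s)(\nu_1\partial_1^2+\nu_2\partial_2^2+\nu_3\partial_3^2)}\,\mathbb{P}\operatorname{div}(u\otimes u)(s)\,ds,$$ where $\mathbb{P}$ is the Leray projection onto divergence-free vector fields. The lifespan $T^\star\in(0,\infty]$ is the supremum of the $T$ for which the (unique) strong solution exists on $[0,T)$. *)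

(* Defs.v *)
From HB Require Import structures.
From mathcomp Require Import all_boot all_order all_algebra.
From mathcomp Require Import all_classical all_reals all_analysis.
Set Implicit Arguments.
Unset Strict Implicit.
Unset Printing Implicit Defensive.
Import Order.TTheory GRing.Theory Num.Theory.
Import numFieldNormedType.Exports.

Local Open Scope classical_set_scope.
Local Open Scope ring_scope.

(* Euclidean space is the iterated product, so that Borel sets, Lebesgue measure
   (as an iterated product measure), Fubini and the normed-space structure all
   come from the library. *)
Notation R3 R := (R * R * R)%type.

Definition mu3 {R : realType} : {measure set
    (measurableTypeR R * measurableTypeR R * measurableTypeR R)%type
      -> \bar R} :=
  ((@lebesgue_measure R \x @lebesgue_measure R) \x @lebesgue_measure R)%E.

Definition coord3 {R : realType} (i : 'I_3) (x : R3 R) : R :=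
  tnth [tuple x.1.1; x.1.2; x.2] i.

Definition dot {R : realType} (x y : R3 R) : R :=
  \sum_(i < 3) coord3 i x * coord3 i y.

(* The norm the library puts on a product is the max norm. *)
Definition enorm {R : realType} (x : R3 R) : R := Num.sqrt (dot x x).

Definition basis_vec {R : realType} (i : 'I_3) : R3 R :=
  ((i == 0 :> nat)%:R, (i == 1 :> nat)%:R, (i == 2 :> nat)%:R).

Definition partial {R : realType} (i : 'I_3) (f : R3 R -> R) : R3 R -> R :=
  fun x => 'D_(basis_vec i) f x.

Definition smooth {R : realType} (f : R3 R -> R) : Prop :=
  forall s : seq 'I_3,
    let g := foldr partial f s in
    continuous g /\ (forall i x, derivable g x (basis_vec i)).

Definition test_function {R : realType} (f : R3 R -> R) : Prop :=
  smooth f /\ compact (closure [set x | f x != 0]).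

Definition Linfty_field {R : realType} (v : R3 R -> R3 R) : Prop :=
  forall i, (coord3 i \o v) \in Lfun mu3 +oo%E.

Definition div_free {R : realType} (v : R3 R -> R3 R) : Prop :=
  forall phi : R3 R -> R, test_function phi ->
    \int[mu3]_x (\sum_(i < 3) coord3 i (v x) * partial i phi x) = 0.

(* Elements of L^oo are classes modulo null sets, so decay is essential decay. *)
Definition vanishes_at_infinity {R : realType} (v : R3 R -> R3 R) : Prop :=
  forall e : R, 0 < e -> exists M : R,
    {ae mu3, forall x, M <= enorm x -> enorm (v x) <= e}.

(* Real part of the inverse Fourier transform
     (2 pi)^-3 \int e^(i x.xi) (a(xi) + i b(xi)) dxi.
   When a is even and b is odd the transform is real, hence equal to this. *)
Definition inv_fourier {R : realType} (a b : R3 R -> R) (x : R3 R) : R :=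
  ((2 * pi) ^+ 3)^-1 *
  \int[mu3]_xi (a xi * cos (dot x xi) - b xi * sin (dot x xi)).

Definition convolution {R : realType} (k f : R3 R -> R) (x : R3 R) : R :=
  \int[mu3]_y (k (x - y) * f y).

(* Fourier symbol of exp(t (nu_1 d_1^2 + nu_2 d_2^2 + nu_3 d_3^2)). *)
Definition heat_symbol {R : realType} (nu : R3 R) (t : R) (xi : R3 R) : R :=
  expR (- t * \sum_(i < 3) coord3 i nu * coord3 i xi ^+ 2).

(* At t = 0 the kernel is a Dirac mass. *)
Definition heat {R : realType} (nu : R3 R) (t : R) (f : R3 R -> R) :
    R3 R -> R :=
  if t == 0 then f else convolution (inv_fourier (heat_symbol nu t) (cst 0)) f.

(* Fourier symbol of the Leray projection P = Id - grad Delta^-1 div. *)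
Definition leray_symbol {R : realType} (i j : 'I_3) (xi : R3 R) : R :=
  (i == j)%:R - coord3 i xi * coord3 j xi / dot xi xi.

(* The Leray projection does not act on L^oo, but for t > 0 the composite
   exp(t (nu_1 d_1^2 + nu_2 d_2^2 + nu_3 d_3^2)) P div does: it maps the matrix
   field F to the vector field with i-th component \sum_(j, k) K_ijk * F_jk,
   where the integrable kernel K_ijk has the purely imaginary odd symbol
   i xi_k P_ij(xi) exp(- t (nu_1 xi_1^2 + nu_2 xi_2^2 + nu_3 xi_3^2)). *)
Definition heat_leray_div_kernel {R : realType} (nu : R3 R) (t : R)
    (i j k : 'I_3) : R3 R -> R :=
  inv_fourier (cst 0)
    (fun xi => coord3 k xi * leray_symbol i j xi * heat_symbol nu t xi).

Definition heat_leray_div {R : realType} (nu : R3 R) (t : R)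
    (F : 'I_3 -> 'I_3 -> R3 R -> R) (i : 'I_3) (x : R3 R) : R :=
  \sum_(j < 3) \sum_(k < 3)
    convolution (heat_leray_div_kernel nu t i j k) (F j k) x.

Definition otimes {R : realType} (v w : R3 R -> R3 R) (j k : 'I_3)
    (x : R3 R) : R :=
  coord3 j (v x) * coord3 k (w x).

(* A time-dependent field is in L^oo([0, T']; L^oo) for all T' < T when it is
   jointly measurable and its spatial L^oo norm is essentially bounded on each
   [0, T']. *)
Definition Linfty_loc {R : realType} (T : R) (u : R -> R3 R -> R3 R) : Prop :=
  measurable_fun (`[0, T[ `*` [set: R3 R]) (fun tx : R * R3 R => u tx.1 tx.2) /\
  forall T' : R, T' < T -> exists M : R,
    {ae lebesgue_measure, forall t : R, t \in `[0, T'] ->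
      forall i, ('N[mu3]_+oo[EFin \o (coord3 i \o u t)] <= M%:E)%E}.

Definition strong_solution {R : realType} (nu : R3 R) (u0 : R3 R -> R3 R)
    (T : R) (u : R -> R3 R -> R3 R) : Prop :=
  Linfty_loc T u /\
  forall t : R, 0 <= t < T ->
    {ae mu3, forall x, forall i,
      coord3 i (u t x) =
        heat nu t (coord3 i \o u0) x
        - \int[lebesgue_measure]_(s in `[0, t])
            heat_leray_div nu (t - s) (otimes (u s) (u s)) i x}.

Definition lifespan {R : realType} (nu : R3 R) (u0 : R3 R -> R3 R) : \bar R :=
  ereal_sup [set T%:E | T in
    [set T : R | 0 < T /\ exists u, strong_solution nu u0 T u]].

(* Main.v *)
(* Writing [1 / |xi|^2] as the integral of [exp (- tau |xi|^2)] over [tau >= 0]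
   turns the kernel of the heat flow composed with the Leray projection and the
   divergence into a superposition of derivatives of anisotropic Gaussians.
   Bounding one-dimensional Fourier integrals by Lorentzians, one gets that its
   L^1 norm is at most [C (t nu3)^(-1/2)] uniformly in [nu1 >= nu2].  Since [u0]
   decays at infinity and the heat kernel spreads in the first variable, the
   free evolution is at most [h] at all times [t >= delta] once [nu1] is large,
   while it stays at most [A] before.  For [delta] and [h] small in terms of the
   given horizon [T], the Duhamel map then contracts, with factor 1/2 in the
   sup norm on [0, T), a set of fields bounded by [2 A + 2 h] before [delta]
   and by [2 h] afterwards.  Its fixed point is a strong solution on [0, T). *)
Require Import Defs.
From HB Require Import structures.
From mathcomp Require Import all_boot all_order all_algebra.
From mathcomp Require Import all_classical all_reals all_analysis.
From mathcomp Require Import measurable_realfun ess_sup_inf ring lra.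
Set Implicit Arguments.
Unset Strict Implicit.
Unset Printing Implicit Defensive.
Import Order.TTheory GRing.Theory Num.Theory.
Import numFieldNormedType.Exports.
Local Open Scope classical_set_scope.
Local Open Scope ring_scope.

(** Uniformity in nu1 rests on one remark: a Lorentzian has mass pi at every scale, so a product of
    three of them has an L^1 norm blind to the anisotropy, while each frequency factor xi_k of a
    symbol costs at most one inverse power of the smallest radius sqrt(t nu3 + tau). For a symbol of
    degree three this leaves (t nu3 + tau)^(-3/2), whose integral over tau >= 0 is 2 (t nu3)^(-1/2).
    The obstacle to a long horizon is that the free evolution is not small near t = 0, however large
    nu1 is. But the singularity (t - s)^(-1/2) is integrable: a source of size A^2 confined to [0,
    delta) contributes O(A^2 sqrt delta) at every time, and the remaining source, of size h^2,
    contributes O(h^2 sqrt T), which is below h once h is small. So h, then delta, are fixed from T,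
    nu3 and the data, and nu1 is chosen last. The iteration runs on genuine functions bounded at
    every point, so that all sup norms are pointwise; null sets enter only through the initial
    datum. *)

(** * Preliminaries on measures and integrals *)

Lemma sigma_finite_product d1 d2 (T1 : measurableType d1)
    (T2 : measurableType d2) (R : realType)
    (m1 : {sigma_finite_measure set T1 -> \bar R})
    (m2 : {sigma_finite_measure set T2 -> \bar R}) :
  sigma_finite setT (m1 \x m2)%E.
Proof.
have /sigma_finiteP[F [TF ndF Foo]] := sigma_finiteT m1.
have /sigma_finiteP[G [TG ndG Goo]] := sigma_finiteT m2.
exists (fun n => F n `*` G n).
  rewrite -setXTT TF TG predeqE => -[x y]; split => /=.
    move=> [[n _ Fnx] [k _ Gky]]; exists (maxn n k) => //; split.
    - by move: x Fnx; exact/subsetPset/ndF/leq_maxl.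
    - by move: y Gky; exact/subsetPset/ndG/leq_maxr.
  by move=> [n _ []/= ? ?]; split; exists n.
move=> k; have [? ?] := Foo k; have [? ?] := Goo k.
split; first exact: measurableX.
by rewrite product_measure1E// lte_mul_pinfty// ge0_fin_numE.
Qed.

Definition plane_measure {R : realType} :
    set (measurableTypeR R * measurableTypeR R)%type -> \bar R :=
  (@lebesgue_measure R \x @lebesgue_measure R)%E.
HB.instance Definition _ (R : realType) := Measure.on (@plane_measure R).
HB.instance Definition _ (R : realType) := Measure_isSigmaFinite.Build _ _ _
  (@plane_measure R)
  (sigma_finite_product (@lebesgue_measure R) (@lebesgue_measure R)).

(* A copy of [mu3] carrying the sigma-finite structure: the only such structure
   the library attaches to products is the one of subprobabilities. *)
Definition space_measure {R : realType} :
    set (measurableTypeR R * measurableTypeR R * measurableTypeR R)%type ->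
    \bar R :=
  (@plane_measure R \x @lebesgue_measure R)%E.
HB.instance Definition _ (R : realType) := Measure.on (@space_measure R).
HB.instance Definition _ (R : realType) := Measure_isSigmaFinite.Build _ _ _
  (@space_measure R)
  (sigma_finite_product (@plane_measure R) (@lebesgue_measure R)).
(** The real integral is [fine] of a difference of integrals of positive and negative parts, each
    measurable by Tonelli. Kernels defined by Fourier integrals are thus jointly measurable before
    anything is known about their size. *)
Lemma measurable_Rintegral_param d1 d2 (T1 : measurableType d1)
    (T2 : measurableType d2) (R : realType)
    (m2 : {sigma_finite_measure set T2 -> \bar R}) (f : T1 * T2 -> R) :
  measurable_fun setT f ->
  measurable_fun setT (fun x => \int[m2]_y f (x, y)).
Proof.
move=> mf; apply: (measurableT_comp (@fine_measurable R setT measurableT)).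
have mF : measurable_fun setT (EFin \o f) by exact/measurable_EFinP.
have e x : (\int[m2]_y (f (x, y))%:E = \int[m2]_y ((EFin \o f)^\+ (x, y)) -
    \int[m2]_y ((EFin \o f)^\- (x, y)))%E.
  by rewrite integralE; congr (_ - _)%E; apply: eq_integral => y _;
     rewrite !(funeposE, funenegE).
under eq_fun do rewrite e.
apply: emeasurable_funB.
- apply: (@measurable_fun_fubini_tonelli_F _ _ T1 T2 R m2 (EFin \o f)^\+%E).
    exact: measurable_funepos.
  by move=> ?; exact: funepos_ge0.
- apply: (@measurable_fun_fubini_tonelli_F _ _ T1 T2 R m2 (EFin \o f)^\-%E).
    exact: measurable_funeneg.
  by move=> ?; exact: funeneg_ge0.
Qed.

(** Monotone convergence along an exhaustion: improper integrals get bounded through the fundamental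
    theorem of calculus on compact intervals. *)
Lemma le_integral_nondecreasing_sets d (T : measurableType d) (R : realType)
    (m : {measure set T -> \bar R}) (F : (set T)^nat) (f : T -> \bar R) c :
  nondecreasing_seq F -> (forall n, measurable (F n)) ->
  measurable_fun (\bigcup_n F n) f -> (forall x, 0 <= f x)%E ->
  (forall n, \int[m]_(x in F n) f x <= c)%E ->
  (\int[m]_(x in \bigcup_n F n) f x <= c)%E.
Proof.
move=> ndF mF mf f0 Fc.
have cv := @ge0_nondecreasing_set_cvg_integral _ T R F f m ndF mF.
have {}cv := cv (fun i => measurable_funS (bigcup_measurable (fun k _ => mF k))
  (bigcup_sup I) mf) (fun i x _ => f0 x).
rewrite -(cvg_lim _ cv)//; apply: lime_le; first by apply/cvg_ex; eexists; exact: cv.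
exact: nearW.
Qed.
Lemma integrable_of_le d (T : measurableType d) (R : realType)
    (m : {measure set T -> \bar R}) (f : T -> R) (c : R) :
  measurable_fun setT f -> (\int[m]_x `|f x|%:E <= c%:E)%E ->
  m.-integrable setT (EFin \o f).
Proof.
move=> mf fc; apply/integrableP; split; first exact/measurable_EFinP.
by apply: le_lt_trans fc _; exact: ltry.
Qed.

Lemma normr_Rintegral_le d (T : measurableType d) (R : realType)
    (m : {measure set T -> \bar R}) (f : T -> R) (c : R) :
  measurable_fun setT f -> (\int[m]_x `|f x|%:E <= c%:E)%E ->
  `|\int[m]_x f x| <= c.
Proof.
move=> mf fc; have fi := integrable_of_le mf fc.
apply: le_trans (le_normr_Rintegral measurableT fi) _.
rewrite -lee_fin /Rintegral fineK//.
have := integrable_norm fi => /integrableP[_].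
rewrite ge0_fin_numE; last by apply: integral_ge0 => x _; rewrite lee_fin.
under eq_integral do rewrite /= normr_id.
by [].
Qed.

Lemma bigcup_itv_natT (R : realType) :
  \bigcup_n `[- (n.+1%:R), n.+1%:R]%classic = [set: R].
Proof.
apply/seteqP; split => // x _; exists (Num.truncn `|x|) => //=.
have h : `|x| <= (Num.truncn `|x|).+1%:R.
  by apply/ltW; rewrite truncnS_gt.
by rewrite in_itv/= -ler_norml.
Qed.

Lemma itv_nat_nondecreasing (R : realType) :
  nondecreasing_seq (fun n => `[- (n.+1%:R), n.+1%:R]%classic : set R).
Proof.
move=> n m nm; apply/subsetPset => x /=; rewrite !in_itv/= -!ler_norml.
by move=> /le_trans; apply; rewrite ler_nat.
Qed.

Lemma integral_is_derive (R : realType) (F f : R -> R) (a b : R) : a < b ->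
  continuous f -> (forall x, is_derive x (1 : R) F (f x)) ->
  (\int[lebesgue_measure]_(x in `[a, b]) (f x)%:E = (F b - F a)%:E)%E.
Proof.
move=> ab cf dF; rewrite (@continuous_FTC2 R f F)//.
- exact: continuous_subspaceT.
- have cF x : {for x, continuous F}.
    by apply/differentiable_continuous/derivable1_diffP/ex_derive; exact: dF.
  split; first by move=> x _; case: (dF x).
    exact: cvg_at_right_filter (cF a).
  exact: cvg_at_left_filter (cF b).
- by move=> x _; rewrite derive1E; case: (dF x).
Qed.

Lemma le_integral_is_derive (R : realType) (F f : R -> R) (B : R) :
  continuous f -> (forall x, is_derive x (1 : R) F (f x)) -> (forall x, 0 <= f x) ->
  (forall x, `|F x| <= B) ->
  (\int[lebesgue_measure]_x (f x)%:E <= (2 * B)%:E)%E.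
Proof.
move=> cf dF f0 FB; rewrite -bigcup_itv_natT.
apply: le_integral_nondecreasing_sets => //.
- exact: itv_nat_nondecreasing.
- rewrite bigcup_itv_natT; apply/measurable_EFinP.
  exact: continuous_measurable_fun.
- move=> n; rewrite (integral_is_derive _ cf dF); last first.
    by rewrite -subr_gt0 opprK addr_gt0.
  rewrite lee_fin; have := FB n.+1%:R; have := FB (- n.+1%:R).
  rewrite !ler_norml; lra.
Qed.

(** Vanishing of the boundary terms in an integration by parts over the line. As [f] is integrable,
    dominated convergence allows exhausting the line by intervals with integer endpoints. *)
Lemma Rintegral_is_derive_eq0 (R : realType) (F f : R -> R) :
  continuous f -> (forall x, is_derive x (1 : R) F (f x)) ->
  lebesgue_measure.-integrable setT (EFin \o f) ->
  F n.+1%:R @[n --> \oo] --> 0 -> F (- n.+1%:R) @[n --> \oo] --> 0 ->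
  \int[lebesgue_measure]_x f x = 0.
Proof.
move=> cf dF fi Fp Fn.
pose D n : set R := `[- (n.+1%:R), n.+1%:R]%classic.
pose g n := (EFin \o f) \_ (D n).
have mf : measurable_fun setT (EFin \o f) by case/integrableP: fi.
have lim0 : (F n.+1%:R - F (- n.+1%:R))%:E @[n --> \oo] --> 0%E.
  apply: cvg_EFin; first exact: nearW.
  rewrite /comp/= -[0 in X in _ --> X]subr0; exact: cvgB.
have h : (\int[lebesgue_measure]_x (f x)%:E = 0)%E.
  have [| | | | |_ _] := @dominated_convergence _ _ _ lebesgue_measure setT
    measurableT g (EFin \o f) (fun x => `|(f x)%:E|)%E.
  - move=> n; apply/(measurable_restrictT _ _).1; first exact: measurable_itv.
    exact: measurable_funTS.
  - exact: mf.
  - apply: aeW => x _; apply: cvg_near_cst.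
    have : [set: R] x by []; rewrite -bigcup_itv_natT => -[k _ Dkx].
    near=> n; rewrite /g /patch mem_set//.
    have /subsetPset : (D k <= D n)%O.
      by apply: itv_nat_nondecreasing; near: n; exact: nbhs_infty_ge.
    exact.
  - exact: (integrable_abse fi).
  - apply: aeW => x n _; rewrite /g /patch; case: ifP => //= _.
    by rewrite lee_fin normr0.
  have -> : (fun n => \int[lebesgue_measure]_(x in setT) g n x)%E =
    (fun n => (F n.+1%:R - F (- n.+1%:R))%:E).
    apply/funext => n; rewrite /g -integral_mkcond.
    rewrite -(integral_is_derive _ cf dF)//.
    by rewrite -subr_gt0 opprK addr_gt0.
  by move=> /(cvg_unique _ lim0) <-.
by rewrite /Rintegral h.
Unshelve. all: by end_near.
Qed.
Lemma integrableM_le1 d (T : measurableType d) (R : realType)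
    (m : {measure set T -> \bar R}) (f h : T -> R) :
  measurable_fun setT h -> (forall x, `|h x| <= 1) ->
  m.-integrable setT (EFin \o f) ->
  m.-integrable setT (EFin \o (fun x => f x * h x)).
Proof.
move=> mh h1 fi.
have mf : measurable_fun setT f by case/integrableP : fi => /measurable_EFinP.
apply: (le_integrable measurableT _ _ fi).
  by apply/measurable_EFinP; exact: measurable_funM.
by move=> x _; rewrite /= lee_fin normrM ler_piMr.
Qed.

Lemma measurable_fun_cos d (T : measurableType d) (R : realType) (f : T -> R) :
  measurable_fun setT f -> measurable_fun setT (fun x => cos (f x)).
Proof.
move=> mf; apply: (measurableT_comp _ mf).
by apply: continuous_measurable_fun => x; exact: continuous_cos.
Qed.

(** Lets bounds stated for cosines with an arbitrary phase cover sine transforms as well. *)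
Lemma sin_cos_shift (R : realType) (x : R) : sin x = cos (x - pi / 2).
Proof. by rewrite cosB cos_pihalf sin_pihalf mulr0 mulr1 add0r. Qed.

Lemma normr_cos_le1 (R : realType) (x : R) : `|cos x| <= 1.
Proof. by rewrite ler_norml cos_geN1 cos_le1. Qed.

Section product.
Context d1 d2 (T1 : measurableType d1) (T2 : measurableType d2)
  (R : realType) (m1 : {sigma_finite_measure set T1 -> \bar R})
  (m2 : {sigma_finite_measure set T2 -> \bar R}).

Lemma measurable_fun_comp_fst d (T : measurableType d) (f : T1 -> T) :
  measurable_fun setT f -> measurable_fun setT (fun z : T1 * T2 => f z.1).
Proof. by move=> mf; apply: (measurableT_comp mf); exact: measurable_fst. Qed.

Lemma measurable_fun_comp_snd d (T : measurableType d) (f : T2 -> T) :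
  measurable_fun setT f -> measurable_fun setT (fun z : T1 * T2 => f z.2).
Proof. by move=> mf; apply: (measurableT_comp mf); exact: measurable_snd. Qed.

Lemma integrable_prod (f : T1 -> R) (g : T2 -> R) :
  m1.-integrable setT (EFin \o f) -> m2.-integrable setT (EFin \o g) ->
  (m1 \x m2)%E.-integrable setT (EFin \o (fun z => f z.1 * g z.2)).
Proof.
move=> fi gi.
have mf : measurable_fun setT f by case/integrableP : fi => /measurable_EFinP.
have mg : measurable_fun setT g by case/integrableP : gi => /measurable_EFinP.
apply/integrable12ltyP.
  apply/measurable_EFinP; apply: measurable_funM.
    exact: measurable_fun_comp_fst.
  exact: measurable_fun_comp_snd.
have [_ gy] := (integrableP _ _ _ gi); have [_ fy] := integrableP _ _ _ fi.
rewrite (_ : (fun x => _) = fun x => (`|(f x)%:E| * \int[m2]_y `|(g y)%:E|)%E).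
  rewrite ge0_integralZr//; last 2 first.
  - by apply: measurableT_comp => //; exact/measurable_EFinP.
  - exact: integral_ge0.
  by rewrite lte_mul_pinfty// ?integral_ge0// ge0_fin_numE// ?integral_ge0.
apply/funext => x; rewrite -ge0_integralZl//.
  by apply: eq_integral => y _; rewrite /= normrM EFinM.
by apply: measurableT_comp => //; exact/measurable_EFinP.
Qed.

Lemma Rintegral_prod (f : T1 -> R) (g : T2 -> R) :
  m1.-integrable setT (EFin \o f) -> m2.-integrable setT (EFin \o g) ->
  \int[(m1 \x m2)%E]_z (f z.1 * g z.2) = (\int[m1]_x f x) * \int[m2]_y g y.
Proof.
move=> fi gi; rewrite /Rintegral.
rewrite -(@integral12_prod_meas1 _ _ _ _ _ m1 m2 _ (integrable_prod fi gi)).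
rewrite -fineM//; [|exact: (integrable_fin_num _ fi)|exact: (integrable_fin_num _ gi)].
have /fineK <- := integrable_fin_num measurableT gi.
rewrite -integralZr//; congr fine; apply: eq_integral => x _; rewrite /fubini_F/=.
rewrite fineK; last exact: integrable_fin_num gi.
by rewrite -integralZl//; apply: eq_integral => y _; rewrite EFinM.
Qed.

(* The phases are arbitrary, so a bound on all phase shifts of the one-variable
   integrals controls both terms of the addition formula for cos. *)
Lemma Rintegral_prod_cos_le (f p : T1 -> R) (g q : T2 -> R) (c1 c2 : R) :
  measurable_fun setT p -> measurable_fun setT q ->
  m1.-integrable setT (EFin \o f) -> m2.-integrable setT (EFin \o g) ->
  (forall a, `|\int[m1]_x (f x * cos (p x + a))| <= c1) ->
  (forall a, `|\int[m2]_x (g x * cos (q x + a))| <= c2) ->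
  forall a, `|\int[(m1 \x m2)%E]_z
    (f z.1 * g z.2 * cos (p z.1 + q z.2 + a))| <= 2 * c1 * c2.
Proof.
move=> mp mq fi gi fc gc a.
have fci b : m1.-integrable setT (EFin \o (fun x => f x * cos (p x + b))).
  apply: integrableM_le1 => // [|x]; last exact: normr_cos_le1.
  by apply: measurable_fun_cos; exact: measurable_funD.
have gci b : m2.-integrable setT (EFin \o (fun x => g x * cos (q x + b))).
  apply: integrableM_le1 => // [|x]; last exact: normr_cos_le1.
  by apply: measurable_fun_cos; exact: measurable_funD.
rewrite (_ : (fun z => _) = fun z =>
   f z.1 * cos (p z.1 + 0) * (g z.2 * cos (q z.2 + a)) -
   f z.1 * cos (p z.1 - pi / 2) * (g z.2 * cos (q z.2 + (a - pi / 2)))); last first.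
  apply/funext => z; rewrite addr0 [q z.2 + (a - _)]addrA -!sin_cos_shift.
  by rewrite -(addrA (p z.1)) (cosD (p z.1)); ring.
rewrite RintegralB//; last 2 first.
- exact: integrable_prod (fci 0) (gci a).
- exact: integrable_prod (fci (- (pi / 2))) (gci (a - pi / 2)).
rewrite (Rintegral_prod (fci 0) (gci a)).
rewrite (Rintegral_prod (fci (- (pi / 2))) (gci (a - pi / 2))).
apply: (le_trans (ler_normB _ _)); rewrite !normrM -mulrA mulr_natl mulr2n.
by apply: lerD; apply: ler_pM.
Qed.

End product.

(** * Time integrals of the singularity (t - s)^(-1/2) *)

Lemma integral_rsqrt (R : realType) (t c d : R) : c < d -> d < t ->
  (\int[lebesgue_measure]_(s in `[c, d]) ((Num.sqrt (t - s))^-1)%:E =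
   (2 * Num.sqrt (t - c) - 2 * Num.sqrt (t - d))%:E)%E.
Proof.
move=> cd dt.
pose F (s : R) : R := - 2 * Num.sqrt (t - s).
have dF (s : R) : s < t -> is_derive s (1 : R) F (Num.sqrt (t - s))^-1.
  move=> st; rewrite /F.
  have ts0 : 0 < t - s by rewrite subr_gt0.
  have h1 : is_derive s (1 : R) (fun s : R => t - s) (-1).
    by apply: is_derive_eq; ring.
  have h2 := is_derive1_sqrt ts0.
  have h3 := @is_derive1_comp _ (@Num.sqrt R) (fun s : R => t - s) s _ _ h2 h1.
  have h4 : is_derive s (1 : R) (fun s : R => - 2 * Num.sqrt (t - s))
     (- 2 * ((2 * Num.sqrt (t - s))^-1 * (-1))) by exact: is_deriveZ.
  apply: is_derive_eq.
  by rewrite invfM; lra.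
have cF (s : R) : s < t -> {for s, continuous F}.
  move=> st; apply/differentiable_continuous/derivable1_diffP.
  by case: (dF s st).
have cd' (s : R) : s \in `[c, d] -> s < t.
  by rewrite in_itv/= => /andP[_ /le_lt_trans]; exact.
rewrite (@continuous_FTC2 R (fun s => (Num.sqrt (t - s))^-1) F)//.
- by rewrite -EFinB /F; congr EFin; ring.
- apply: continuous_in_subspaceT => s; rewrite inE/= => /cd' st.
  apply: cvgV; first by rewrite gt_eqF// sqrtr_gt0 subr_gt0.
  apply: (@continuous_comp _ _ _ (fun s : R => t - s) (@Num.sqrt R)).
    by apply: cvgB; [exact: cvg_cst|exact: cvg_id].
  exact: sqrt_continuous.
- split.
  + move=> s; rewrite in_itv/= => /andP[_ sd].
    by case: (dF s (lt_trans sd dt)).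
  + by apply: cvg_at_right_filter; apply: cF; exact: lt_trans dt.
  + by apply: cvg_at_left_filter; exact: cF.
- move=> s; rewrite in_itv/= => /andP[_ sd].
  by rewrite derive1E; case: (dF s (lt_trans sd dt)).
Qed.

Lemma measurable_fun_inv d (T : measurableType d) (R : realType) (f : T -> R) :
  measurable_fun setT f -> measurable_fun setT (fun x => (f x)^-1).
Proof.
(* The power function agrees with the inverse on nonnegative reals, hence the square. Where [f]
   vanishes both sides are 0, because [0^-1 = 0]. *)
move=> mf; rewrite (_ : (fun x => _) = fun x => f x * ((f x ^+ 2) `^ (-1))).
  apply: measurable_funM => //.
  have mf2 : measurable_fun setT (fun x => f x ^+ 2) by exact: measurable_funX.
  exact: (measurableT_comp (measurable_powR (-1)) mf2).
apply/funext => x; rewrite powR_inv1 ?sqr_ge0//.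
have [->|fx0] := eqVneq (f x) 0; first by rewrite invr0 mul0r.
by field.
Qed.

Lemma measurable_fun_sqrt d (T : measurableType d) (R : realType) (f : T -> R) :
  measurable_fun setT f -> measurable_fun setT (fun x => Num.sqrt (f x)).
Proof.
move=> mf; apply: (measurableT_comp _ mf).
by apply: continuous_measurable_fun => x; exact: sqrt_continuous.
Qed.

Lemma le_integral_rsqrt (R : realType) (t c : R) : c <= t ->
  (\int[lebesgue_measure]_(s in `[c, t]) ((Num.sqrt (t - s))^-1)%:E <=
   (2 * Num.sqrt (t - c))%:E)%E.
Proof.
have mf (D : set R) :
    measurable_fun D (fun s : R => ((Num.sqrt (t - s))^-1)%:E).
  apply: measurable_funTS; apply/measurable_EFinP.
  by apply: measurable_fun_inv; apply: measurable_fun_sqrt; apply: measurable_funB.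
rewrite le_eqVlt => /orP[/eqP <-|ct].
  by rewrite set_itv1 integral_set1 subrr sqrtr0 mulr0.
rewrite -integral_itv_bndo_bndc//.
(* The primitive is differentiable only away from [t], so the singular endpoint is approached
   through compact intervals. *)
have -> : `[c, t[%classic = \bigcup_n `[c, t - n.+1%:R^-1]%classic :> set R.
  apply/seteqP; split => x /=; rewrite in_itv/=.
    move=> /andP[cx xt].
    have [n nx] : exists n : nat, n.+1%:R^-1 < t - x.
      exists (Num.truncn (t - x)^-1).
      rewrite -[X in _ < X]invrK ltf_pV2 ?posrE// ?invr_gt0 ?subr_gt0//.
      by rewrite truncnS_gt.
    by exists n => //=; rewrite in_itv/= cx/= lerBrDr addrC -lerBrDr ltW.
  move=> [n _]/=; rewrite in_itv/= => /andP[-> /le_lt_trans]; apply.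
  by rewrite ltrBlDr ltrDl invr_gt0.
apply: le_integral_nondecreasing_sets => //.
- move=> n m nm; apply/subsetPset => x/=; rewrite !in_itv/= => /andP[-> /le_trans].
  by apply; rewrite lerD2l lerN2 lef_pV2 ?posrE// ler_nat.
- exact: mf.
(* For small [n] the interval may be empty or reduced to [c]; its integral is then 0. *)
- move=> n; have [cd|dc] := ltP c (t - n.+1%:R^-1).
    rewrite integral_rsqrt//; last by rewrite ltrBlDr ltrDl invr_gt0.
    by rewrite lee_fin gerBl mulr_ge0 ?sqrtr_ge0.
  rewrite (@integral_Sset1 _ _ _ c).
    by rewrite lee_fin mulr_ge0 ?sqrtr_ge0.
  move=> x/=; rewrite in_itv/= => /andP[cx xd].
  by apply/eqP; rewrite eq_le cx (le_trans xd dc).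
Qed.

(** A source that is large only before time [e] costs sqrt e, not sqrt t. For [e < t] the integral
    over [0, e) is 2 (sqrt t - sqrt (t - e)), at most 2 sqrt e because the square root is
    subadditive. *)
Lemma le_integral_rsqrt_step (R : realType) (t e a b : R) :
  0 <= t -> 0 <= e -> 0 <= a -> 0 <= b ->
  (\int[lebesgue_measure]_(s in `[0%R, t])
      ((Num.sqrt (t - s))^-1 * (a * (s < e)%R%:R + b))%:E <=
   (2 * a * Num.sqrt e + 2 * b * Num.sqrt t)%:E)%E.
Proof.
move=> t0 e0 a0 b0; pose r (s : R) := (Num.sqrt (t - s))^-1.
have r0 s : 0 <= r s by rewrite invr_ge0 sqrtr_ge0.
have mr : measurable_fun setT r.
  by apply: measurable_fun_inv; apply: measurable_fun_sqrt; apply: measurable_funB.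
have me : measurable_fun setT (fun s : R => (s < e)%R%:R : R).
  rewrite (_ : (fun s => _) = \1_(`]-oo, e[%classic)).
    exact: measurable_indic.
  by apply/funext => s; rewrite indicE; congr (nat_of_bool _)%:R;
    apply/idP/idP; rewrite inE/= in_itv.
rewrite (_ : (fun s => _) = fun s => (a%:E * (r s * (s < e)%R%:R)%:E +
    b%:E * (r s)%:E)%E); last first.
  by apply/funext => s; rewrite -!EFinM -EFinD /r; congr EFin; ring.
have mre D : measurable_fun D (fun s => (r s * (s < e)%R%:R)%:E).
  by apply: measurable_funTS; apply/measurable_EFinP; exact: measurable_funM.
have mr' D : measurable_fun D (EFin \o r).
  by apply: measurable_funTS; apply/measurable_EFinP.
rewrite ge0_integralD//; last 4 first.
- by move=> s _; rewrite -EFinM lee_fin !mulr_ge0.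
- by apply: measurable_funeM; exact: mre.
- by move=> s _; rewrite -EFinM lee_fin !mulr_ge0.
- by apply: measurable_funeM; exact: mr'.
rewrite !ge0_integralZl//; last 4 first.
- exact: mr'.
- by move=> s _; rewrite lee_fin.
- exact: mre.
- by move=> s _; rewrite lee_fin mulr_ge0.
rewrite (_ : _ + _ = a * (2 * Num.sqrt e) + b * (2 * Num.sqrt t)); last by ring.
rewrite EFinD 2!(EFinM _ (2 * _)); apply: leeD; apply: lee_wpmul2l;
  rewrite ?lee_fin//; last first.
  by rewrite -{2}(subr0 t); exact: le_integral_rsqrt.
have [te|et] := leP t e.
  apply: (@le_trans _ _ (\int[lebesgue_measure]_(s in `[0%R, t]) (r s)%:E)%E).
    apply: ge0_le_integral => //.
    - by move=> s _; rewrite lee_fin mulr_ge0.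
    - exact: mre.
    - exact: mr'.
    - by move=> s _; rewrite lee_fin ler_piMr// lern1 leq_b1.
  apply: le_trans (le_integral_rsqrt t0) _.
  by rewrite subr0 lee_fin ler_wpM2l// ler_wsqrtr.
rewrite (_ : (\int[lebesgue_measure]_(s in _) _)%E =
  (\int[lebesgue_measure]_(s in `[0%R, e[) (r s)%:E)%E); last first.
  rewrite [RHS]integral_mkcond [LHS]integral_mkcond; apply: eq_integral => s _.
  rewrite /patch/= !mem_setE !in_itv/=.
  have [se|es] := ltP s e; last by rewrite andbF mulr0; case: ifP.
  by rewrite mulr1 andbT (le_trans (ltW se) (ltW et)) andbT.
move: e0; rewrite le_eqVlt => /orP[/eqP <-|e0].
  by rewrite set_itvco0 integral_set0 sqrtr0 mulr0.
rewrite integral_itv_bndo_bndc// integral_rsqrt// lee_fin subr0 -mulrBr.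
rewrite ler_wpM2l// lerBlDr -(@ler_pXn2r _ 2)// ?nnegrE ?addr_ge0 ?sqrtr_ge0//.
rewrite sqrrD !sqr_sqrtr ?subr_ge0 ?(ltW et) ?(ltW e0)//.
have : 0 <= Num.sqrt e * Num.sqrt (t - e) by rewrite mulr_ge0 ?sqrtr_ge0.
lra.
Qed.
Lemma le_integral_prod d1 d2 (T1 : measurableType d1) (T2 : measurableType d2)
    (R : realType) (m1 : {sigma_finite_measure set T1 -> \bar R})
    (m2 : {sigma_finite_measure set T2 -> \bar R}) (f : T1 -> R) (g : T2 -> R)
    (a b : R) :
  measurable_fun setT f -> measurable_fun setT g ->
  (forall x, 0 <= f x) -> (forall y, 0 <= g y) ->
  (\int[m1]_x (f x)%:E <= a%:E)%E -> (\int[m2]_y (g y)%:E <= b%:E)%E ->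
  (\int[(m1 \x m2)%E]_z (f z.1 * g z.2)%:E <= (a * b)%:E)%E.
Proof.
move=> mf mg f0 g0 fa gb.
rewrite (@fubini_tonelli1 _ _ _ _ _ m1 m2 (fun z => (f z.1 * g z.2)%:E)); last 2 first.
- apply/measurable_EFinP; apply: measurable_funM.
    exact: measurable_fun_comp_fst.
  exact: measurable_fun_comp_snd.
- by move=> z; rewrite lee_fin mulr_ge0.
rewrite (_ : fubini_F _ _ = fun x => ((f x)%:E * \int[m2]_y (g y)%:E)%E); last first.
  apply/funext => x; rewrite /fubini_F/= -ge0_integralZl ?lee_fin//.
  - exact/measurable_EFinP.
  - by move=> y _; rewrite lee_fin.
rewrite ge0_integralZr//; last 3 first.
- exact/measurable_EFinP.
- by move=> x _; rewrite lee_fin.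
- by apply: integral_ge0 => y _; rewrite lee_fin.
rewrite EFinM; apply: lee_pmul => //.
- by apply: integral_ge0 => y _; rewrite lee_fin.
- by apply: integral_ge0 => y _; rewrite lee_fin.
Qed.

(** Up to the factor pi, the Cauchy density of width [1/s]: its maximum is [s] and its mass is pi
    for every [s > 0]. *)
Definition lorentz {R : realType} (s x : R) : R := s / (1 + (s * x) ^+ 2).

(** * One-dimensional oscillatory integrals *)

Section lorentz.
Context {R : realType}.
Implicit Types s x y : R.

Let den_gt0 s x : 0 < 1 + (s * x) ^+ 2.
Proof. by rewrite ltr_wpDr ?sqr_ge0. Qed.

Lemma lorentz_ge0 s x : 0 <= s -> 0 <= lorentz s x.
Proof. by move=> s0; rewrite divr_ge0// ltW. Qed.

Lemma lorentz_le s x : 0 <= s -> lorentz s x <= s.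
Proof. by move=> s0; rewrite ler_pdivrMr// ler_peMr// lerDl sqr_ge0. Qed.

Lemma continuous_lorentz s : continuous (lorentz s).
Proof.
move=> x; apply: cvgM; first exact: cvg_cst.
apply: cvgV; first by rewrite gt_eqF.
apply: cvgD; first exact: cvg_cst.
apply: (@continuous_comp _ _ _ ( *%R s) (fun y => y ^+ 2)).
  exact: mulrl_continuous.
exact: exprn_continuous.
Qed.

Lemma measurable_fun_lorentz d (T : measurableType d) (f g : T -> R) :
  measurable_fun setT f -> measurable_fun setT g ->
  measurable_fun setT (fun z => lorentz (f z) (g z)).
Proof.
move=> mf mg; apply: measurable_funM => //; apply: measurable_fun_inv.
by apply: measurable_funD => //; apply: measurable_funX; exact: measurable_funM.
Qed.

Lemma le_integral_lorentz s y : 0 < s ->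
  (\int[lebesgue_measure]_x (lorentz s (y - x))%:E <= (pi : R)%:E)%E.
Proof.
move=> s0; rewrite (_ : pi = 2 * (pi / 2)); last by field.
apply: (@le_integral_is_derive _ (fun x => - atan (s * (y - x)))).
- move=> x; apply: (@continuous_comp _ _ _ (fun x => y - x) (lorentz s)).
    by apply: cvgB; [exact: cvg_cst|exact: cvg_id].
  exact: continuous_lorentz.
- move=> x.
  have h1 : is_derive x (1 : R) (fun x => s * (y - x)) (- s).
    by apply: is_derive_eq; rewrite /GRing.scale/=; ring.
  have h2 := is_derive1_atan (s * (y - x)).
  have h3 := @is_derive1_comp _ atan (fun x => s * (y - x)) x _ _ h2 h1.
  have h4 := is_deriveN h3.
  apply: is_derive_eq; rewrite /lorentz; field.
  by rewrite gt_eqF.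
- by move=> x; exact/lorentz_ge0/ltW.
- by move=> x; rewrite normrN ler_norml !ltW ?atan_gtNpi2 ?atan_ltpi2.
Qed.

End lorentz.

Section gaussian_monomials.
Context {R : realType}.
Implicit Types (y : R) (k m : nat).

Definition gmon k y : R := y ^+ k * expR (- y ^+ 2).

(** With u = 1 + y^2, raising u/(k+1) <= exp(u/(k+1)) to the power k+1 gives u^(k+1) <= (k+1)^(k+1)
    exp u. Since |y| <= u, the product |y|^k u exp(-y^2) is at most (k+1)^(k+1) exp 1. *)
Lemma gmon_le k : exists2 c, 0 <= c & forall y, `|gmon k y| <= c * lorentz 1 y.
Proof.
exists (k.+1%:R ^+ k.+1 * expR 1).
  by rewrite mulr_ge0 ?expR_ge0 ?exprn_ge0.
move=> y; pose u := 1 + y ^+ 2.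
have u0 : 0 < u by rewrite ltr_wpDr ?sqr_ge0.
rewrite /lorentz !mul1r -/u ler_pdivlMr// /gmon normrM normrX (ger0_norm (expR_ge0 _)).
have hu : u ^+ k.+1 <= k.+1%:R ^+ k.+1 * expR u.
  have : u / k.+1%:R <= expR (u / k.+1%:R).
    by apply: le_trans (expR_ge1Dx _); rewrite lerDr.
  rewrite -(@ler_pXn2r _ k.+1)// ?nnegrE ?expR_ge0 ?divr_ge0 ?(ltW u0)//.
  rewrite expr_div_n ler_pdivrMr ?exprn_gt0// -expRM_natl.
  by rewrite mulrCA divff// mulr1 mulrC.
have yu : `|y| <= u.
  by have := sqr_ge0 (`|y| - 1); rewrite sqrrB real_normK ?num_real// /u;
    have := normr_ge0 y; nra.
rewrite mulrAC.
apply: (@le_trans _ _ (u ^+ k.+1 * expR (- y ^+ 2))).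
  by rewrite ler_wpM2r ?expR_ge0// exprSr ler_wpM2r ?(ltW u0)// lerXn2r ?nnegrE
    ?(ltW u0).
apply: le_trans (ler_wpM2r (expR_ge0 _) hu) _.
by rewrite -mulrA -expRD /u addrK.
Qed.

(** At [k = 0] the truncated predecessor is harmless, its coefficient being 0. *)
Definition gmon' k y : R := k%:R * gmon k.-1 y - 2 * gmon k.+1 y.

Lemma is_derive_gmon k y : is_derive y (1 : R) (gmon k) (gmon' k y).
Proof.
have he : is_derive y (1 : R) (fun z : R => expR (- z ^+ 2))
    (expR (- y ^+ 2) * (- (2 * y))).
  have h1 : is_derive y (1 : R) (fun z : R => - z ^+ 2) (- (2 * y)).
    by apply: is_derive_eq; rewrite /GRing.scale/=; ring.
  exact: (@is_derive1_comp _ expR (fun z => - z ^+ 2) y _ _ _ h1).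
have hX : is_derive y (1 : R) (fun z : R => z ^+ k) (k%:R * y ^+ k.-1).
  have h := @is_deriveX R R (id : R -> R) k y 1 1 (is_derive_id _ _).
  apply: (@is_derive_eq _ _ _ _ _ _ _ _ _ ) => [|/=]; last exact: mulr1.
  by rewrite (_ : (fun z => _) = (id : R -> R) ^+ k)//; apply/funext => z; rewrite fctE.
have h := is_deriveM hX he.
apply: is_derive_eq; rewrite /gmon' /gmon /GRing.scale/= (exprS y k); ring.
Qed.

Definition gmon'' k y : R := k%:R * gmon' k.-1 y - 2 * gmon' k.+1 y.

Lemma is_derive_gmon' k y : is_derive y (1 : R) (gmon' k) (gmon'' k y).
Proof.
have h1 := is_derive_gmon k.-1 y; have h2 := is_derive_gmon k.+1 y.
rewrite /gmon'; apply: is_derive_eq; rewrite /gmon'' /GRing.scale/=; ring.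
Qed.

Lemma continuous_is_derive (f f' : R -> R) :
  (forall y, is_derive y (1 : R) f (f' y)) -> continuous f.
Proof.
move=> df y; apply/differentiable_continuous/derivable1_diffP.
by case: (df y).
Qed.

Lemma continuous_gmon k : continuous (gmon k).
Proof. exact: continuous_is_derive (is_derive_gmon k). Qed.

Lemma continuous_gmon' k : continuous (gmon' k).
Proof. exact: continuous_is_derive (is_derive_gmon' k). Qed.

Lemma continuous_gmon'' k : continuous (gmon'' k).
Proof.
move=> y; apply: cvgB; apply: cvgM; try exact: cvg_cst; exact: continuous_gmon'.
Qed.

Let combination_le (k : nat) (u v a b L : R) : `|u| <= a * L -> `|v| <= b * L ->
  `|k%:R * u - 2 * v| <= (k%:R * a + 2 * b) * L.
Proof.
move=> ua vb; apply: le_trans (ler_normB _ _) _.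
by rewrite !normrM !normr_nat (mulrDl (k%:R * a)) -!mulrA; apply: lerD;
  apply: ler_wpM2l.
Qed.

(** A single constant for the three functions that two integrations by parts involve. *)
Lemma gmon_derivatives_le k : exists2 c, 0 <= c &
  forall y, [/\ `|gmon k y| <= c * lorentz 1 y, `|gmon' k y| <= c * lorentz 1 y
    & `|gmon'' k y| <= c * lorentz 1 y].
Proof.
have le' j : exists2 c, 0 <= c & forall y, `|gmon' j y| <= c * lorentz 1 y.
  have [a a0 ha] := gmon_le j.-1; have [b b0 hb] := gmon_le j.+1.
  exists (j%:R * a + 2 * b); first by rewrite addr_ge0 ?mulr_ge0.
  by move=> y; exact: combination_le.
have [a a0 ha] := gmon_le k; have [b b0 hb] := le' k.
have [c c0 hc] := le' k.-1; have [d d0 hd] := le' k.+1.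
have L y : 0 <= lorentz 1 y by exact: lorentz_ge0.
exists (a + b + (k%:R * c + 2 * d)); first by rewrite !addr_ge0 ?mulr_ge0.
move=> y; split.
- by apply: le_trans (ha y) _; rewrite ler_wpM2r// -addrA lerDl !addr_ge0 ?mulr_ge0.
- apply: le_trans (hb y) _; rewrite ler_wpM2r// addrAC lerDr !addr_ge0 ?mulr_ge0//.
- apply: (@le_trans _ _ ((k%:R * c + 2 * d) * lorentz 1 y)); last first.
    by rewrite ler_wpM2r// lerDr !addr_ge0.
  exact: combination_le.
Qed.

End gaussian_monomials.

Section gaussian_oscillation.
Context {R : realType}.
Implicit Types (x y r : R) (k : nat).

Lemma continuous_measurable_comp_scale (f : R -> R) r :
  continuous f -> measurable_fun setT (fun xi => f (r * xi)).
Proof.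
move=> cf; apply: continuous_measurable_fun => x.
apply: (@continuous_comp _ _ _ ( *%R r) f); first exact: mulrl_continuous.
exact: cf.
Qed.

(** The change of variables is made on the majorant only: [lorentz 1 (r * xi)] equals
    [lorentz r xi / r]. *)
Lemma le_integral_lorentz_bound (f : R -> R) c r : 0 <= c -> 0 < r ->
  measurable_fun setT (fun xi => f (r * xi)) ->
  (forall y, `|f y| <= c * lorentz 1 y) ->
  (\int[lebesgue_measure]_xi `|f (r * xi)|%:E <= (c * pi / r)%:E)%E.
Proof.
move=> c0 r0 mf fc.
have e xi : c * lorentz 1 (r * xi) = c / r * lorentz r (0 - xi).
  rewrite /lorentz sub0r mulrN sqrrN mul1r; field.
  by rewrite (gt_eqF r0)/= gt_eqF// ltr_wpDr// sqr_ge0.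
have mL : measurable_fun setT (fun xi : R => lorentz r (0 - xi)).
  by apply: measurable_fun_lorentz => //; exact: measurable_funB.
apply: (@le_trans _ _ (\int[lebesgue_measure]_xi (c / r * lorentz r (0 - xi))%:E)%E).
  apply: ge0_le_integral => //.
  - by apply/measurable_EFinP; exact: measurableT_comp.
  - by apply/measurable_EFinP; exact: measurable_funM.
  - by move=> xi _; rewrite lee_fin -e.
under eq_integral do rewrite EFinM.
rewrite ge0_integralZl//; last 3 first.
- exact/measurable_EFinP.
- by move=> xi _; rewrite lee_fin lorentz_ge0// ltW.
- by rewrite lee_fin divr_ge0// ltW.
rewrite (mulrAC c pi) (EFinM (c / r) pi); apply: lee_wpmul2l;
  first by rewrite lee_fin divr_ge0// ltW.
exact: le_integral_lorentz.
Qed.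

Lemma cvg_lorentz_bound (g : nat -> R) c r : 0 < r ->
  (forall n, `|g n| <= c * lorentz 1 (r * n.+1%:R)) -> g n @[n --> \oo] --> 0.
Proof.
move=> r0 gc; apply/norm_cvg0P.
apply: (@squeeze_cvgr _ _ _ _ (cst 0) (fun n => `|c| / r ^+ 2 * n.+1%:R^-1)).
- apply: nearW => n; rewrite normr_ge0/=; apply: le_trans (gc n) _.
  apply: (@le_trans _ _ (`|c| * lorentz 1 (r * n.+1%:R))).
    by rewrite ler_wpM2r ?lorentz_ge0// ler_norm.
  rewrite -mulrA ler_wpM2l// /lorentz !mul1r -invfM lef_pV2 ?posrE.
  + rewrite exprMn; apply: (@le_trans _ _ (r ^+ 2 * n.+1%:R ^+ 2)).
      by rewrite ler_wpM2l ?sqr_ge0// expr2 ler_peMr// ler1n.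
    by rewrite lerDr.
  + by rewrite ltr_wpDr ?sqr_ge0.
  + by rewrite mulr_gt0 ?exprn_gt0.
- exact: cvg_cst.
- rewrite -[0 in X in _ --> X](mulr0 (`|c| / r ^+ 2)); apply: cvgM.
    exact: cvg_cst.
  exact: cvg_harmonic.
Qed.

(** Let I be the oscillatory integral. The L^1 norm bounds |I| by c pi / r, and two integrations by
    parts bound (x/r)^2 |I| by the same quantity. The sum of both is the Lorentzian bound, with the
    factor 2. Nothing depends on the phase [a]. *)
Lemma gmon_oscillation k : exists2 C : R, 0 <= C & forall r, 0 < r ->
  (\int[lebesgue_measure]_xi `|gmon k (r * xi)|%:E <= (C / r)%:E)%E /\
  forall x a, `|\int[lebesgue_measure]_xi (gmon k (r * xi) * cos (x * xi + a))|
    <= C * lorentz r^-1 x.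
Proof.
have [c c0 hc] := gmon_derivatives_le (R := R) k.
exists (2 * (c * pi)); first by rewrite !mulr_ge0 ?pi_ge0.
move=> r r0.
have m0 := continuous_measurable_comp_scale r (@continuous_gmon R k).
have m2 := continuous_measurable_comp_scale r (@continuous_gmon'' R k).
have i0 := le_integral_lorentz_bound c0 r0 m0 (fun y => let: And3 h _ _ := hc y in h).
have i2 := le_integral_lorentz_bound c0 r0 m2 (fun y => let: And3 _ _ h := hc y in h).
split.
  apply: le_trans i0 _; rewrite lee_fin ler_wpM2r ?invr_ge0 ?(ltW r0)//.
  by rewrite ler_peMl ?mulr_ge0 ?pi_ge0// ler1n.
move=> x a.
pose h xi := gmon k (r * xi); pose h' xi := r * gmon' k (r * xi).
pose h'' xi := r ^+ 2 * gmon'' k (r * xi).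
pose cs xi := cos (x * xi + a); pose sn xi := sin (x * xi + a).
have scale (f f' : R -> R) : (forall y, is_derive y (1 : R) f (f' y)) ->
    forall xi, is_derive xi (1 : R) (fun xi => f (r * xi)) (r * f' (r * xi)).
  move=> df xi.
  have h1 : is_derive xi (1 : R) (fun xi => r * xi) r.
    by apply: is_derive_eq; rewrite /GRing.scale/=; ring.
  have h2 := @is_derive1_comp _ f (fun xi => r * xi) xi _ _ (df (r * xi)) h1.
  by apply: is_derive_eq; rewrite mulrC.
have dh xi : is_derive xi (1 : R) h (h' xi) := scale _ _ (is_derive_gmon k) xi.
have dh' xi : is_derive xi (1 : R) h' (h'' xi).
  have h1 := scale _ _ (is_derive_gmon' k) xi.
  by rewrite /h'; apply: is_derive_eq; rewrite /h'' /GRing.scale/=; ring.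
have dphase xi : is_derive xi (1 : R) (fun xi => x * xi + a) x.
  by apply: is_derive_eq; rewrite /GRing.scale/=; ring.
have dcs xi : is_derive xi (1 : R) cs (- (x * sn xi)).
  have h1 := @is_derive1_comp _ cos (fun xi => x * xi + a) xi _ _
    (is_derive_cos _) (dphase xi).
  by rewrite /cs; apply: is_derive_eq; rewrite /sn; ring.
have dsn xi : is_derive xi (1 : R) sn (x * cs xi).
  have h1 := @is_derive1_comp _ sin (fun xi => x * xi + a) xi _ _
    (is_derive_sin _) (dphase xi).
  by rewrite /sn; apply: is_derive_eq; rewrite /cs; ring.
(* Two integrations by parts at once: the derivative of [G] is
   [- (x^2 h + h'') cos]. *)
pose G xi := - (x * (h xi * sn xi)) - h' xi * cs xi.
pose G' xi := - (x ^+ 2 * (h xi * cs xi)) - h'' xi * cs xi.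
have dG xi : is_derive xi (1 : R) G (G' xi).
  have := dh xi; have := dh' xi; have := dcs xi; have := dsn xi => d1 d2 d3 d4.
  by rewrite /G; apply: is_derive_eq; rewrite /G' /GRing.scale/=; ring.
have mcs : measurable_fun setT cs.
  by apply: measurable_fun_cos; apply: measurable_funD => //; exact: measurable_funM.
have cs1 xi : `|cs xi| <= 1 by exact: normr_cos_le1.
have sn1 xi : `|sn xi| <= 1 by rewrite /sn sin_cos_shift normr_cos_le1.
have ih : lebesgue_measure.-integrable setT (EFin \o (fun xi => h xi * cs xi)).
  by apply: integrableM_le1 => //; exact: integrable_of_le i0.
have ih2 : lebesgue_measure.-integrable setT (EFin \o (fun xi => h'' xi * cs xi)).
  apply: integrableM_le1 => //.
  have := integrable_of_le (m := lebesgue_measure) m2 i2 =>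
    /(integrableZl measurableT (r ^+ 2)).
  by apply: eq_integrable.
have bnd (f : R -> R) e : measurable_fun setT f ->
    (\int[lebesgue_measure]_xi `|f xi|%:E <= e%:E)%E ->
    `|\int[lebesgue_measure]_xi (f xi * cs xi)| <= e.
  move=> mf fe; apply: normr_Rintegral_le; first exact: measurable_funM.
  apply: le_trans fe; apply: ge0_le_integral => //.
  - by apply/measurable_EFinP; apply: measurableT_comp => //; exact: measurable_funM.
  - by apply/measurable_EFinP; exact: measurableT_comp.
  - by move=> xi _; rewrite lee_fin normrM ler_piMr.
set I := \int[_]_xi _.
have I0 : `|I| <= c * pi / r by exact: bnd i0.
have I2 : x ^+ 2 * I =
    - (r ^+ 2 * \int[lebesgue_measure]_xi (gmon'' k (r * xi) * cs xi)).
  have cG' : continuous G'.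
    have ch := continuous_is_derive dh; have ccs := continuous_is_derive dcs.
    have ch2 : continuous h''.
      move=> xi; apply: cvgM; first exact: cvg_cst.
      apply: (@continuous_comp _ _ _ ( *%R r) (gmon'' k)).
        exact: mulrl_continuous.
      exact: continuous_gmon''.
    move=> xi; apply: cvgB; last by apply: cvgM; [exact: ch2|exact: ccs].
    by apply: cvgN; apply: cvgM; [exact: cvg_cst|apply: cvgM; [exact: ch|exact: ccs]].
  have G_le xi : `|G xi| <= (`|x| + r) * c * lorentz 1 (r * xi).
    have [H0 H1 _] := hc (r * xi).
    apply: le_trans (ler_normB _ _) _; rewrite normrN -mulrA mulrDl.
    apply: lerD.
      rewrite (normrM x) ler_wpM2l// (normrM (h xi)); apply: le_trans H0.
      by rewrite ler_piMr.
    rewrite (normrM (h' xi)) /h' (normrM r) (gtr0_norm r0) -mulrA.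
    by rewrite ler_wpM2l ?(ltW r0)//; apply: le_trans H1; rewrite ler_piMr.
  have -> : r ^+ 2 * \int[lebesgue_measure]_xi (gmon'' k (r * xi) * cs xi) =
      \int[lebesgue_measure]_xi (h'' xi * cs xi).
    rewrite -RintegralZl//.
      by apply: eq_Rintegral => xi _; rewrite /h'' mulrA.
    by apply: integrableM_le1 => //; exact: integrable_of_le i2.
  have iG' : lebesgue_measure.-integrable setT
      (EFin \o (fun xi => - x ^+ 2 * (h xi * cs xi))).
    by have := integrableZl measurableT (- x ^+ 2) ih; apply: eq_integrable.
  have := Rintegral_is_derive_eq0 cG' dG.
  have -> : G' = fun xi => - x ^+ 2 * (h xi * cs xi) - h'' xi * cs xi.
    by apply/funext => xi; rewrite /G' mulNr.
  rewrite RintegralB// RintegralZl// -/I mulNr => H.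
  apply/eqP; rewrite -subr_eq0 opprK -oppr_eq0 opprD; apply/eqP/H.
  - by have := integrableB measurableT iG' ih2; apply: eq_integrable.
  - by apply: (cvg_lorentz_bound r0) => n; exact: G_le.
  - apply: (cvg_lorentz_bound r0) => n; apply: le_trans (G_le _) _.
    by rewrite /lorentz !mul1r mulrN sqrrN.
have {}I2 : x ^+ 2 * `|I| <= r ^+ 2 * (c * pi / r).
  rewrite -(ger0_norm (sqr_ge0 x)) -normrM I2 normrN normrM (ger0_norm (sqr_ge0 r)).
  by rewrite ler_wpM2l ?sqr_ge0//; exact: bnd i2.
rewrite /lorentz mulrA ler_pdivlMr ?ltr_wpDr ?sqr_ge0//.
rewrite mulrDr mulr1 -mulrA mulr2n mulrDl mul1r; apply: lerD => //.
have -> : `|I| * (r^-1 * x) ^+ 2 = x ^+ 2 * `|I| / r ^+ 2.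
  by field; rewrite gt_eqF.
by rewrite ler_pdivrMr ?exprn_gt0// [leRHS]mulrC.
Qed.

End gaussian_oscillation.

(** * Coordinates of the space and measurability *)

Section measurability.
Context d (T : measurableType d) {R : realType}.

Lemma measurable_fun_fst d1 d2 (T1 : measurableType d1) (T2 : measurableType d2)
    (f : T -> T1 * T2) :
  measurable_fun setT f -> measurable_fun setT (fun z => (f z).1).
Proof. by move=> mf; exact: (measurableT_comp measurable_fst mf). Qed.

Lemma measurable_fun_snd d1 d2 (T1 : measurableType d1) (T2 : measurableType d2)
    (f : T -> T1 * T2) :
  measurable_fun setT f -> measurable_fun setT (fun z => (f z).2).
Proof. by move=> mf; exact: (measurableT_comp measurable_snd mf). Qed.

Lemma measurable_fun_expR (f : T -> R) :
  measurable_fun setT f -> measurable_fun setT (fun z => expR (f z)).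
Proof. by move=> mf; exact: (measurableT_comp (@measurable_expR R) mf). Qed.

Lemma measurable_fun_sin (f : T -> R) :
  measurable_fun setT f -> measurable_fun setT (fun z => sin (f z)).
Proof.
move=> mf; apply: (measurableT_comp _ mf).
by apply: continuous_measurable_fun => x; exact: continuous_sin.
Qed.

Lemma measurable_fun_nat_ler (f g : T -> R) :
  measurable_fun setT f -> measurable_fun setT g ->
  measurable_fun setT (fun z => (f z <= g z)%R%:R : R).
Proof.
move=> mf mg; rewrite (_ : (fun z => _) = fun z => if f z <= g z then 1 else 0).
  by apply: measurable_fun_ifT => //; exact: measurable_fun_ler.
by apply/funext => z; case: ifP.
Qed.

Lemma coord3E (x : R3 R) : (coord3 0 x = x.1.1) * (coord3 1 x = x.1.2) *
  (coord3 2 x = x.2).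
Proof. by []. Qed.

Lemma sum3E (F : 'I_3 -> R) : \sum_(i < 3) F i = F 0 + F 1 + F 2.
Proof.
rewrite !big_ord_recl big_ord0 addr0 addrA.
by congr (F _ + F _ + F _); apply/val_inj.
Qed.

Lemma measurable_fun_coord3 (i : 'I_3) (f : T -> R3 R) :
  measurable_fun setT f -> measurable_fun setT (fun z => coord3 i (f z)).
Proof.
move=> mf; case: i => -[|[|[|//]]] ?.
- exact: (measurable_fun_fst (measurable_fun_fst mf)).
- exact: (measurable_fun_snd (measurable_fun_fst mf)).
- exact: (measurable_fun_snd mf).
Qed.

Lemma measurable_fun_dot (f g : T -> R3 R) :
  measurable_fun setT f -> measurable_fun setT g ->
  measurable_fun setT (fun z => dot (f z) (g z)).
Proof.
move=> mf mg; apply: measurable_sum => i.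
by apply: measurable_funM; exact: measurable_fun_coord3.
Qed.

Lemma measurable_fun_R3 (f : T -> R3 R) :
  (forall i, measurable_fun setT (fun z => coord3 i (f z))) -> measurable_fun setT f.
Proof.
move=> mf; rewrite (_ : f = fun z => ((f z).1.1, (f z).1.2, (f z).2)).
  apply: measurable_fun_pair; last exact: (mf 2).
  by apply: measurable_fun_pair; [exact: (mf 0)|exact: (mf 1)].
by apply/funext => z; case: (f z) => -[].
Qed.

Lemma coord3B (i : 'I_3) (x y : R3 R) : coord3 i (x - y) = coord3 i x - coord3 i y.
Proof. by case: i => -[|[|[|//]]]. Qed.

Lemma measurable_fun_subR3 (f g : T -> R3 R) :
  measurable_fun setT f -> measurable_fun setT g ->
  measurable_fun setT (fun z => f z - g z).
Proof.
move=> mf mg; apply: measurable_fun_R3 => i.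
under eq_fun do rewrite coord3B.
by apply: measurable_funB; exact: measurable_fun_coord3.
Qed.

End measurability.

(* Dispatches on the head symbol: letting unification choose among the closure
   lemmas is much slower. *)
Ltac mfun := lazymatch goal with
  | |- measurable_fun _ (fun _ => ?c) => exact: measurable_cst
  | |- measurable_fun _ (fun z => z) => exact: measurable_id
  | |- measurable_fun _ fst => exact: measurable_fst
  | |- measurable_fun _ snd => exact: measurable_snd
  | |- measurable_fun _ (coord3 ?i) =>
      exact: (measurable_fun_coord3 i (@measurable_id _ _ _))
  | |- measurable_fun _ (dot ?x) =>
      exact: (measurable_fun_dot (@measurable_cst _ _ _ _ _ x)
                (@measurable_id _ _ _))
  | |- measurable_fun _ ( *%R ?x) => exact: mulrl_measurable
  | |- measurable_fun _ ( +%R ?x) =>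
      exact: (measurable_funD (@measurable_cst _ _ _ _ _ x)
                (@measurable_id _ _ _))
  | |- measurable_fun _ (fun z => fst z) => exact: measurable_fst
  | |- measurable_fun _ (fun z => snd z) => exact: measurable_snd
  | |- measurable_fun _ (fun z => coord3 _ _) =>
      apply: measurable_fun_coord3; mfun
  | |- measurable_fun _ (fun z => dot _ _) => apply: measurable_fun_dot; mfun
  | |- measurable_fun _ (fun z => expR _) => apply: measurable_fun_expR; mfun
  | |- measurable_fun _ (fun z => cos _) => apply: measurable_fun_cos; mfun
  | |- measurable_fun _ (fun z => sin _) => apply: measurable_fun_sin; mfun
  | |- measurable_fun _ (fun z => Num.sqrt _) =>
      apply: measurable_fun_sqrt; mfun
  | |- measurable_fun _ (fun z => lorentz _ _) =>
      apply: measurable_fun_lorentz; mfun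
  | |- measurable_fun _ (fun z => _ *+ (nat_of_bool _)) =>
      apply: measurable_fun_nat_ler; mfun
  | |- measurable_fun _ (fun z => _ ^+ _) => apply: measurable_funX; mfun
  | |- measurable_fun _ (fun z => _^-1) => apply: measurable_fun_inv; mfun
  | |- measurable_fun _ (fun z => _ * _) => apply: measurable_funM; mfun
  | |- measurable_fun _ (fun z => `|_|) =>
      apply: (measurableT_comp (@normr_measurable _ setT)); mfun
  | |- measurable_fun _ (fun z => - _) => apply: measurable_funN; mfun
  | |- measurable_fun _ (fun z => _ - _) =>
      first [apply: measurable_funB | apply: measurable_fun_subR3]; mfun
  | |- measurable_fun _ (fun z => _ + _) => apply: measurable_funD; mfun
  | |- measurable_fun _ (fun z => fst _) => apply: measurable_fun_fst; mfun
  | |- measurable_fun _ (fun z => snd _) => apply: measurable_fun_snd; mfun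
  | |- _ => try assumption
  end.

(** * Heat and Leray kernels *)

Section space_oscillation.
Context {R : realType}.
Implicit Types (r : R3 R) (k : 'I_3 -> nat).

Definition gauss_monomial k r (xi : R3 R) : R :=
  \prod_(i < 3) gmon (k i) (coord3 i r * coord3 i xi).

(** A product of Lorentzians of width [coord3 i r] in direction [i]: the anisotropic majorant of all
    the kernels. *)
Definition lorentz3 r (x : R3 R) : R :=
  lorentz (coord3 0 r)^-1 (coord3 0 x) * lorentz (coord3 1 r)^-1 (coord3 1 x)
  * lorentz (coord3 2 r)^-1 (coord3 2 x).

Lemma prod3E (F : 'I_3 -> R) : \prod_(i < 3) F i = F 0 * F 1 * F 2.
Proof.
rewrite !big_ord_recl big_ord0 mulr1 mulrA.
by congr (F _ * F _ * F _); apply/val_inj.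
Qed.

Lemma measurable_fun_gmon d (T : measurableType d) j (f : T -> R) :
  measurable_fun setT f -> measurable_fun setT (fun z => gmon j (f z)).
Proof. by move=> mf; rewrite /gmon; mfun. Qed.

(** One constant for finitely many exponents. The symbols met below have degree at most 3, so that
    [n = 3] suffices. *)
Lemma gmon_oscillation_le n : exists2 C : R, 0 <= C & forall j, (j <= n)%N ->
  forall s, 0 < s ->
  (\int[lebesgue_measure]_xi `|gmon j (s * xi)|%:E <= (C / s)%:E)%E /\
  forall x a : R, `|\int[lebesgue_measure]_xi (gmon j (s * xi) * cos (x * xi + a))|
    <= C * lorentz s^-1 x.
Proof.
elim: n => [|n [C C0 HC]].
  by have [C C0 HC] := gmon_oscillation (R := R) 0; exists C => // -[|//] _.
have [D D0 HD] := gmon_oscillation (R := R) n.+1.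
exists (C + D); first exact: addr_ge0.
move=> j; rewrite leq_eqVlt ltnS => /orP[/eqP ->|jn] s s0.
  have [h1 h2] := HD s s0; split => [|x a].
    apply: le_trans h1 _; rewrite lee_fin ler_wpM2r ?invr_ge0 ?(ltW s0)//.
    by rewrite lerDr.
  by apply: le_trans (h2 x a) _;
    rewrite ler_wpM2r ?lorentz_ge0 ?invr_ge0 ?(ltW s0)// lerDr.
have [h1 h2] := HC j jn s s0; split => [|x a].
  apply: le_trans h1 _; rewrite lee_fin ler_wpM2r ?invr_ge0 ?(ltW s0)//.
  by rewrite lerDl.
by apply: le_trans (h2 x a) _;
  rewrite ler_wpM2r ?lorentz_ge0 ?invr_ge0 ?(ltW s0)// lerDl.
Qed.

Lemma gauss_monomial_oscillation : exists2 C : R, 0 <= C & forall k r,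
  (forall i, (k i <= 3)%N) -> (forall i, 0 < coord3 i r) ->
  (\int[mu3]_xi `|gauss_monomial k r xi|%:E <= (C / \prod_(i < 3) coord3 i r)%:E)%E /\
  forall (x : R3 R) (a : R),
    `|\int[mu3]_xi (gauss_monomial k r xi * cos (dot x xi + a))|
    <= C * lorentz3 r x.
Proof.
have [C C0 HC] := gmon_oscillation_le 3.
(* One factor [C] per variable; each of the two uses of [Rintegral_prod_cos_le] costs a factor 2. *)
exists (4 * C ^+ 3); first by rewrite mulr_ge0 ?exprn_ge0.
move=> k r k3 r0.
have H i := HC (k i) (k3 i) _ (r0 i).
have mg i : measurable_fun setT (fun xi : R => gmon (k i) (coord3 i r * xi)).
  by apply: measurable_fun_gmon; mfun.
have ig i := integrable_of_le (m := lebesgue_measure) (mg i) (H i).1.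
have L0 i x : 0 <= lorentz (coord3 i r)^-1 x.
  by rewrite lorentz_ge0// invr_ge0 ltW.
split.
  have h1 := @le_integral_prod _ _ _ _ R lebesgue_measure lebesgue_measure
    (fun xi => `|gmon (k 0) (coord3 0 r * xi)|) (fun xi =>
      `|gmon (k 1) (coord3 1 r * xi)|)
    _ _ (measurableT_comp (@normr_measurable R setT) (mg 0))
    (measurableT_comp (@normr_measurable R setT) (mg 1))
    (fun=> normr_ge0 _) (fun=> normr_ge0 _) (H 0).1 (H 1).1.
  have h2 := @le_integral_prod _ _ _ _ R plane_measure lebesgue_measure
    _ (fun xi => `|gmon (k 2) (coord3 2 r * xi)|)
    _ _ _ (measurableT_comp (@normr_measurable R setT) (mg 2))
    _ (fun=> normr_ge0 _) h1 (H 2).1.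
  apply: le_trans (le_trans _ (h2 _ _)) _.
  - apply: ge0_le_integral => //.
    + apply/measurable_EFinP; apply: measurableT_comp => //.
      rewrite /gauss_monomial; under eq_fun do rewrite prod3E.
      by apply: measurable_funM; [apply: measurable_funM|];
        apply: measurable_fun_gmon; mfun.
    + apply/measurable_EFinP; apply: measurable_funM.
        apply: measurable_funM; apply: measurableT_comp => //;
        apply: measurable_fun_gmon; mfun.
      by apply: measurableT_comp => //; apply: measurable_fun_gmon; mfun.
    + by move=> xi _; rewrite /gauss_monomial prod3E !coord3E lee_fin !normrM.
  - by apply: measurable_funM; apply: measurableT_comp => //;
      apply: measurable_fun_gmon; mfun.
  - by move=> xi; rewrite mulr_ge0.
  rewrite prod3E lee_fin.
  have -> : C / coord3 0 r * (C / coord3 1 r) * (C / coord3 2 r) =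
      C ^+ 3 / (coord3 0 r * coord3 1 r * coord3 2 r).
    by rewrite !invfM; ring.
  rewrite ler_wpM2r ?invr_ge0 ?mulr_ge0 ?(ltW (r0 _))//.
  by rewrite ler_peMl ?exprn_ge0// ler1n.
move=> x a.
have mp i : measurable_fun setT (fun xi : R => coord3 i x * xi) by mfun.
have h1 := @Rintegral_prod_cos_le _ _ _ _ R lebesgue_measure lebesgue_measure
  _ _ _ _ _ _ (mp 0) (mp 1) (ig 0) (ig 1)
  ((H 0).2 (coord3 0 x)) ((H 1).2 (coord3 1 x)).
have i1 := @integrable_prod _ _ _ _ R lebesgue_measure lebesgue_measure
  _ _ (ig 0) (ig 1).
have mp1 : measurable_fun setT
  (fun z : measurableTypeR R * measurableTypeR R =>
    coord3 0 x * z.1 + coord3 1 x * z.2) by mfun.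
have := @Rintegral_prod_cos_le _ _ _ _ R plane_measure lebesgue_measure
  _ _ _ _ _ _ mp1 (mp 2) i1 (ig 2) h1 ((H 2).2 (coord3 2 x)) a.
set I := (X in `|X| <= _ -> _); set J := (X in _ -> `|X| <= _).
have -> : J = I.
  rewrite /I /J; apply: eq_Rintegral => xi _.
  by rewrite /gauss_monomial prod3E /dot sum3E !coord3E.
move=> /le_trans; apply; rewrite le_eqVlt; apply/orP; left; apply/eqP.
by rewrite /lorentz3; ring.
Qed.

End space_oscillation.

Section gaussian_symbols.
Context {R : realType}.
Implicit Types (r : R3 R) (k : 'I_3 -> nat).

Lemma lorentz3_ge0 r x : (forall i, 0 < coord3 i r) -> 0 <= lorentz3 r x.
Proof.
move=> r0; have L i : 0 <= lorentz (coord3 i r)^-1 (coord3 i x).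
  by rewrite lorentz_ge0// invr_ge0 ltW.
exact: mulr_ge0 (mulr_ge0 (L 0) (L 1)) (L 2).
Qed.

Lemma measurable_fun_lorentz3 d (T : measurableType d) (f g : T -> R3 R) :
  measurable_fun setT f -> measurable_fun setT g ->
  measurable_fun setT (fun z => lorentz3 (f z) (g z)).
Proof. by move=> mf mg; rewrite /lorentz3; mfun. Qed.

(** The bound does not see the radii: this is the source of the uniformity in nu1. *)
Lemma le_integral_lorentz3 r (x : R3 R) : (forall i, 0 < coord3 i r) ->
  (\int[mu3]_y (lorentz3 r (x - y))%:E <= (pi ^+ 3 : R)%:E)%E.
Proof.
move=> r0.
have L i := @le_integral_lorentz R (coord3 i r)^-1 (coord3 i x).
have {}L i : (\int[lebesgue_measure]_y
    (lorentz (coord3 i r)^-1 (coord3 i x - y))%:E <= (pi : R)%:E)%E.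
  by apply: L; rewrite invr_gt0.
have L0 i y : 0 <= lorentz (coord3 i r)^-1 (coord3 i x - y).
  by rewrite lorentz_ge0// invr_ge0 ltW.
have mL i : measurable_fun setT
    (fun y : R => lorentz (coord3 i r)^-1 (coord3 i x - y)) by mfun.
have h1 := @le_integral_prod _ _ _ _ R lebesgue_measure lebesgue_measure
  _ _ _ _ (mL 0) (mL 1) (L0 0) (L0 1) (L 0) (L 1).
have h2 := @le_integral_prod _ _ _ _ R plane_measure lebesgue_measure
  _ _ _ _ _ (mL 2) _ (L0 2) h1 (L 2).
have h3 : (\int[mu3]_y (lorentz3 r (x - y))%:E <= (pi * pi * pi : R)%:E)%E.
  apply: h2; first by mfun.
  by move=> z; rewrite mulr_ge0.
by rewrite exprSr expr2.
Qed.

Definition monomial3 k (xi : R3 R) : R := \prod_(i < 3) coord3 i xi ^+ k i.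

Definition gauss_symbol r (xi : R3 R) : R :=
  expR (- \sum_(i < 3) (coord3 i r * coord3 i xi) ^+ 2).

Lemma measurable_fun_monomial3 d (T : measurableType d) k (f : T -> R3 R) :
  measurable_fun setT f -> measurable_fun setT (fun z => monomial3 k (f z)).
Proof.
by move=> mf; apply: measurable_prod => i _; mfun.
Qed.

Lemma measurable_fun_gauss_symbol d (T : measurableType d) (f g : T -> R3 R) :
  measurable_fun setT f -> measurable_fun setT g ->
  measurable_fun setT (fun z => gauss_symbol (f z) (g z)).
Proof.
move=> mf mg; apply/measurable_fun_expR/measurable_funN.
by apply: measurable_sum => i; mfun.
Qed.

Lemma gauss_monomialE k r xi : gauss_monomial k r xi =
  monomial3 k r * (monomial3 k xi * gauss_symbol r xi).
Proof.
rewrite /gauss_monomial /monomial3 /gauss_symbol !prod3E sum3E !opprD !expRD.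
by rewrite /gmon !exprMn; ring.
Qed.

(** Trades the anisotropic factors for a common lower bound on the radii, so that large radii never
    enter the constants. *)
Lemma monomial3_inv_le k r (s : R) : 0 < s -> (forall i, s <= coord3 i r) ->
  (monomial3 k r)^-1 <= s^-1 ^+ (\sum_(i < 3) k i).
Proof.
move=> s0 sr; rewrite exprVn lef_pV2 ?posrE ?exprn_gt0//; last first.
  by apply: prodr_gt0 => i _; rewrite exprn_gt0// (lt_le_trans s0).
rewrite -prodrXr; apply: ler_prod => i _.
by rewrite exprn_ge0 ?(ltW s0)//= lerXn2r// nnegrE ?(ltW s0)// (le_trans (ltW s0)).
Qed.

(** Undoes the scaling of [gauss_monomial]: every frequency factor costs [s^-1]. The additional
    exponent 3 in the L^1 bound comes from the volume factor, the inverse product of the radii; in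
    the pointwise bound [lorentz3] carries it. *)
Lemma gauss_symbol_oscillation : exists2 C : R, 0 <= C & forall k r (s : R),
  (forall i, (k i <= 3)%N) -> 0 < s -> (forall i, s <= coord3 i r) ->
  let n := (\sum_(i < 3) k i)%N in
  (\int[mu3]_xi `|monomial3 k xi * gauss_symbol r xi|%:E <=
    (C * s^-1 ^+ (n + 3))%:E)%E /\
  forall x a, `|\int[mu3]_xi
      (monomial3 k xi * gauss_symbol r xi * cos (dot x xi + a))|
    <= C * s^-1 ^+ n * lorentz3 r x.
Proof.
have [C C0 HC] := gauss_monomial_oscillation (R := R).
exists C => // k r s k3 s0 sr n.
have r0 i : 0 < coord3 i r by exact: lt_le_trans (sr i).
have [H1 H2] := HC k r k3 r0.
have W0 : 0 < monomial3 k r by apply: prodr_gt0 => i _; rewrite exprn_gt0.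
have E xi : monomial3 k xi * gauss_symbol r xi =
  (monomial3 k r)^-1 * gauss_monomial k r xi.
  by rewrite gauss_monomialE mulKf// gt_eqF.
have mgm : measurable_fun setT (gauss_monomial k r).
  rewrite (_ : gauss_monomial k r =
    fun xi => monomial3 k r * (monomial3 k xi * gauss_symbol r xi)).
    apply: measurable_funM => //; apply: measurable_funM.
      exact: measurable_fun_monomial3.
    exact: measurable_fun_gauss_symbol.
  by apply/funext => xi; exact: gauss_monomialE.
have W := monomial3_inv_le k s0 sr.
split => [|x a].
  under eq_integral do rewrite E normrM EFinM.
  rewrite ge0_integralZl//; last first.
    by apply/measurable_EFinP; apply: measurableT_comp.
  apply: le_trans (lee_wpmul2l _ H1) _; first by rewrite lee_fin.
  rewrite gtr0_norm ?invr_gt0// -EFinM lee_fin mulrCA ler_wpM2l//.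
  rewrite exprD ler_pM ?invr_ge0 ?(ltW W0)//.
    by rewrite prodr_ge0// => i _; exact: ltW.
  rewrite exprVn lef_pV2 ?posrE ?exprn_gt0//.
    rewrite prod3E !exprS expr0 mulr1 mulrA.
    by rewrite !ler_pM ?mulr_ge0 ?(ltW s0).
  by apply: prodr_gt0.
under eq_Rintegral do rewrite E -mulrA.
rewrite RintegralZl//; last first.
  apply: integrableM_le1 => //; first by mfun.
  - by move=> xi; exact: normr_cos_le1.
  - exact: integrable_of_le H1.
rewrite normrM gtr0_norm ?invr_gt0// (mulrC C) -mulrA.
by apply: ler_pM => //; rewrite invr_ge0 ltW.
Qed.

End gaussian_symbols.

Section subordination.
Context {R : realType}.

(** Half-line integrals are written over the whole line with a Boolean factor, so that they fit
    Fubini on a full product space. The integrand here is the exponential density of rate [q],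
    divided by [q]. *)
Lemma integral_expR_tail (q : R) : 0 < q ->
  (\int[lebesgue_measure]_tau ((0 <= tau)%R%:R * expR (- (tau * q)))%:E =
   q^-1%:E)%E.
Proof.
move=> q0.
have E tau : (((0 <= tau)%R%:R * expR (- (tau * q)))%:E =
    q^-1%:E * (exponential_pdf q tau)%:E)%E.
  rewrite -EFinM /exponential_pdf /patch mem_setE in_itv/= andbT.
  case: ifP => _; last by rewrite mul0r mulr0.
  by rewrite mul1r mulrA mulVf ?gt_eqF// mul1r mulrC mulNr.
under eq_integral do rewrite E.
rewrite ge0_integralZl//.
- by rewrite integral_exponential_pdf// mule1.
- by apply/measurable_EFinP; exact: measurable_exponential_pdf.
- by move=> x _; rewrite lee_fin exponential_pdf_ge0// ltW.
- by rewrite lee_fin invr_ge0 ltW.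
Qed.

(** With [c = t * nu3] this produces the singularity (t nu3)^(-1/2) of the Leray part of the kernel.
    The primitive is -2 (c + s)^(-1/2). *)
Lemma le_integral_rsqrt3_tail (c : R) : 0 < c ->
  (\int[lebesgue_measure]_tau
     ((0 <= tau)%R%:R * (Num.sqrt (c + tau))^-1 ^+ 3)%:E <=
   (2 * (Num.sqrt c)^-1)%:E)%E.
Proof.
move=> c0; pose f (s : R) : R := (Num.sqrt (c + s))^-1 ^+ 3.
pose F (s : R) : R := - 2 * (Num.sqrt (c + s))^-1.
have sqrt0 s : 0 <= s -> 0 < Num.sqrt (c + s).
  by move=> s0; rewrite sqrtr_gt0 ltr_wpDr.
have dF (s : R) : 0 <= s -> is_derive s (1 : R) F (f s).
  move=> s0; rewrite /F.
  have h1 : is_derive s (1 : R) (fun s : R => c + s) 1.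
    by apply: is_derive_eq; ring.
  have cs0 : 0 < c + s by rewrite ltr_wpDr.
  have h2 := is_derive1_sqrt cs0.
  have h3 := @is_derive1_comp _ (@Num.sqrt R) (fun s : R => c + s) s _ _ h2 h1.
  have h4 := @is_deriveV _ (fun s : R => Num.sqrt (c + s)) s _ 1
    (lt0r_neq0 (sqrt0 s s0)) h3.
  have h5 : is_derive s (1 : R) (fun s : R => - 2 * (Num.sqrt (c + s))^-1)
      (- 2 * (- (Num.sqrt (c + s)) ^- 2 *: ((2 * Num.sqrt (c + s))^-1 * 1))).
    exact: is_deriveZ.
  apply: is_derive_eq; rewrite /f /GRing.scale/=; field.
  by rewrite gt_eqF// sqrt0.
have mf D : measurable_fun D (EFin \o (fun s : R => (0 <= s)%R%:R * f s)).
  by apply: measurable_funTS; apply/measurable_EFinP; rewrite /f; mfun.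
rewrite -bigcup_itv_natT; apply: le_integral_nondecreasing_sets => //.
- exact: itv_nat_nondecreasing.
- exact: mf.
move=> n.
have -> : (\int[lebesgue_measure]_(x in `[(- n.+1%:R)%R, n.+1%:R])
    ((0 <= x)%R%:R * (Num.sqrt (c + x))^-1 ^+ 3)%:E =
    \int[lebesgue_measure]_(x in `[0%R, n.+1%:R]) (f x)%:E)%E.
  rewrite [RHS]integral_mkcond [LHS]integral_mkcond; apply: eq_integral => s _.
  rewrite /patch/= !mem_setE !in_itv/=.
  have [s0|s0] := leP 0 s; last by rewrite mul0r; case: ifP.
  by rewrite mul1r/= (le_trans _ s0)// oppr_le0.
have cF s : 0 <= s -> {for s, continuous F}.
  move=> s0; apply/differentiable_continuous/derivable1_diffP.
  by case: (dF s s0).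
rewrite (@continuous_FTC2 R f F)//.
- rewrite -EFinB lee_fin /F addr0.
  have : 0 <= (Num.sqrt (c + n.+1%:R))^-1 by rewrite invr_ge0 sqrtr_ge0.
  by lra.
- apply: continuous_in_subspaceT => s; rewrite inE/= in_itv/= => /andP[s0 _].
  rewrite /f; apply: (@continuous_comp _ _ _ (fun s => (Num.sqrt (c + s))^-1)
    (fun y => y ^+ 3)); last exact: exprn_continuous.
  apply: cvgV; first by rewrite gt_eqF// sqrt0.
  apply: (@continuous_comp _ _ _ (fun s : R => c + s) (@Num.sqrt R)).
    by apply: cvgD; [exact: cvg_cst|exact: cvg_id].
  exact: sqrt_continuous.
- split.
  + by move=> s; rewrite in_itv/= => /andP[s0 _]; case: (dF s (ltW s0)).
  + by apply: cvg_at_right_filter; exact: cF.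
  + by apply: cvg_at_left_filter; exact: cF.
- move=> s; rewrite in_itv/= => /andP[s0 _].
  by rewrite derive1E; case: (dF s (ltW s0)).
Qed.

End subordination.

Lemma ord3_ind (P : 'I_3 -> Prop) : P 0 -> P 1 -> P 2 -> forall i, P i.
Proof.
move=> P0 P1 P2 [[|[|[|//]]] p]; [move: P0|move: P1|move: P2];
  by congr P; exact/val_inj.
Qed.

Section kernels.
Context {R : realType}.
Implicit Types (nu : R3 R) (i j k : 'I_3) (s t : R).

(** The Gaussian with these radii is the symbol of the heat flow of [nu] at time [t] followed by the
    isotropic heat flow at time [tau]. *)
Definition radii nu t (tau : R) : R3 R :=
  (Num.sqrt (t * coord3 0 nu + tau), Num.sqrt (t * coord3 1 nu + tau),
   Num.sqrt (t * coord3 2 nu + tau)).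

Lemma coord3_radii nu t tau i :
  coord3 i (radii nu t tau) = Num.sqrt (t * coord3 i nu + tau).
Proof.
by move: i; apply: ord3_ind.
Qed.

Lemma radii_ge nu t tau s : 0 < t -> (forall i, s <= coord3 i nu) ->
  forall i, Num.sqrt (t * s + tau) <= coord3 i (radii nu t tau).
Proof.
move=> t0 snu i; rewrite coord3_radii ler_wsqrtr// lerD2r.
by rewrite ler_wpM2l// ltW.
Qed.

Lemma radii_gt0 nu t tau s : 0 < t -> 0 < s -> 0 <= tau ->
  (forall i, s <= coord3 i nu) -> forall i, 0 < coord3 i (radii nu t tau).
Proof.
move=> t0 s0 tau0 snu i; apply: lt_le_trans (radii_ge _ t0 snu i).
by rewrite sqrtr_gt0 ltr_wpDr// mulr_gt0.
Qed.

Lemma gauss_symbol_radii nu t tau s xi : 0 < t -> 0 < s -> 0 <= tau ->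
  (forall i, s <= coord3 i nu) ->
  gauss_symbol (radii nu t tau) xi =
  heat_symbol nu t xi * expR (- (tau * dot xi xi)).
Proof.
move=> t0 s0 tau0 snu; rewrite /gauss_symbol /heat_symbol -expRD; congr expR.
rewrite /dot !sum3E !exprMn !coord3_radii !sqr_sqrtr; first by ring.
all: by rewrite addr_ge0// mulr_ge0// ?ltW// (lt_le_trans s0).
Qed.

Lemma measurable_fun_radii d (T : measurableType d) nu (f g : T -> R) :
  measurable_fun setT f -> measurable_fun setT g ->
  measurable_fun setT (fun z => radii nu (f z) (g z)).
Proof.
move=> mf mg; apply: measurable_fun_R3 => i.
rewrite (_ : (fun z => _) = fun z => Num.sqrt (f z * coord3 i nu + g z)).
  by mfun.
by apply/funext => z; rewrite coord3_radii.
Qed.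

Lemma monomial3_coord k xi : monomial3 (fun l => (l == k) : nat) xi = coord3 k xi :> R.
Proof.
rewrite /monomial3 (bigD1 k)//= eqxx expr1 big1 ?mulr1// => l /negbTE ->.
by rewrite expr0.
Qed.

Lemma monomial3D (a b : 'I_3 -> nat) xi :
  monomial3 (fun l => (a l + b l)%N) xi = monomial3 a xi * monomial3 b xi :> R.
Proof. by rewrite /monomial3 -big_split; apply: eq_bigr => l _; exact: exprD. Qed.

Lemma sum_delta k : (\sum_(l < 3) (l == k) = 1)%N.
Proof. by rewrite (bigD1 k)//= eqxx big1 ?addn0// => l /negbTE ->. Qed.

Lemma inv_2pi_bounds : 0 <= ((2 * pi : R) ^+ 3)^-1 <= 1.
Proof.
have p2 : 1 <= 2 * pi :> R by have := pi_ge2 R; lra.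
rewrite invr_ge0 exprn_ge0/=; last by rewrite mulr_ge0 ?pi_ge0.
by rewrite invf_le1 ?exprn_gt0 ?exprn_ege1// (lt_le_trans ltr01).
Qed.

(** The case of degree 0 and [tau = 0]: no inverse power of [s] is left, so that the constant is
    universal. *)
Lemma heat_kernel_le : exists2 C : R, 0 <= C & forall nu t s,
  0 < t -> 0 < s -> (forall i, s <= coord3 i nu) -> forall x,
  `|inv_fourier (heat_symbol nu t) (cst 0) x| <= C * lorentz3 (radii nu t 0) x.
Proof.
have [C C0 HC] := gauss_symbol_oscillation (R := R).
exists C => // nu t s t0 s0 snu x.
have r0 : 0 < Num.sqrt (t * s + 0) by rewrite addr0 sqrtr_gt0 mulr_gt0.
have [_ /(_ x 0)] := HC (fun=> 0%N) _ _ (fun=> isT) r0 (radii_ge 0 t0 snu).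
rewrite big1// expr0 mulr1 => H.
have /andP[c0 c1] := inv_2pi_bounds.
rewrite /inv_fourier normrM (ger0_norm c0).
apply: le_trans (ler_piMl _ c1) _ => //; apply: le_trans H.
rewrite le_eqVlt; apply/orP; left; apply/eqP; congr `|_|.
apply: eq_Rintegral => xi _; rewrite mul0r subr0 addr0.
rewrite (gauss_symbol_radii _ t0 s0)// mul0r oppr0 expR0 mulr1.
by rewrite /monomial3 big1 ?mul1r.
Qed.

End kernels.

Section leray_kernel.
Context {R : realType}.
Implicit Types (nu : R3 R) (i j k : 'I_3) (s t : R).

(** At the origin the quotient by |xi|^2 takes the default value 0. Since the numerator vanishes
    there as well, the subordination identity holds at every frequency. *)
Lemma monomial3_dot0 (a : 'I_3 -> nat) (xi : R3 R) : (\sum_(l < 3) a l != 0)%N ->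
  dot xi xi = 0 -> monomial3 a xi = 0.
Proof.
move=> a0 xi0; have [l al0] : exists l, a l != 0%N.
  apply/existsP; apply: contraNT a0; rewrite negb_exists => /forallP H.
  by rewrite big1// => l _; apply/eqP; move: (H l); rewrite negbK.
have /eqP/psumr_eq0P : \sum_(l < 3) coord3 l xi * coord3 l xi == 0 by exact/eqP.
move=> /(_ (fun l _ => sqr_ge0 _) l isT)/eqP; rewrite mulf_eq0 orbb => /eqP xl0.
by rewrite /monomial3 (bigD1 l)//= xl0 expr0n (negbTE al0) mul0r.
Qed.

(* Writing [1 / |xi|^2] as the integral of [exp (- tau |xi|^2)] over [tau >= 0]
   turns the Leray symbol into a superposition of Gaussians. *)
Lemma subordinated_kernel_le : exists2 C : R, 0 <= C & forall nu t s a,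
  0 < t -> 0 < s -> (forall i, s <= coord3 i nu) ->
  (forall i, (a i <= 3)%N) -> (\sum_(i < 3) a i = 3)%N -> forall x,
  mu3.-integrable setT (EFin \o (fun xi => monomial3 a xi / dot xi xi *
      heat_symbol nu t xi * sin (dot x xi))) /\
  (`|\int[mu3]_xi (monomial3 a xi / dot xi xi * heat_symbol nu t xi *
      sin (dot x xi))|%:E <=
   \int[lebesgue_measure]_tau ((0 <= tau)%R%:R *
      (C * (Num.sqrt (t * s + tau))^-1 ^+ 3 * lorentz3 (radii nu t tau) x))%:E)%E.
Proof.
have [C C0 HC] := gauss_symbol_oscillation (R := R).
exists C => // nu t s a t0 s0 snu a3 suma x.
pose g (xi : R3 R) (tau : R) := monomial3 a xi * gauss_symbol (radii nu t tau) xi.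
pose f (z : R3 R * R) : R := (0 <= z.2)%R%:R * (g z.1 z.2 * sin (dot x z.1)).
have mg : measurable_fun setT (fun z : R3 R * R => g z.1 z.2).
  rewrite /g; apply: measurable_funM; first by apply: measurable_fun_monomial3; mfun.
  by apply: measurable_fun_gauss_symbol; [apply: measurable_fun_radii|]; mfun.
have mf : measurable_fun setT f.
  rewrite /f; apply: measurable_funM; first by mfun.
  by apply: measurable_funM => //; mfun.
have mg1 tau : measurable_fun setT (fun xi => g xi tau).
  rewrite /g; apply: measurable_funM; first by apply: measurable_fun_monomial3; mfun.
  by apply: measurable_fun_gauss_symbol; mfun.
pose rho tau := Num.sqrt (t * s + tau).
have rho_gt0 tau : 0 <= tau -> 0 < rho tau.
  by move=> tau0; rewrite sqrtr_gt0 ltr_wpDr// mulr_gt0.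
have rho0 tau : 0 <= (rho tau)^-1 by rewrite invr_ge0 sqrtr_ge0.
have HCt tau (tau0 : 0 <= tau) := HC a (radii nu t tau) (rho tau) a3
  (rho_gt0 tau tau0) (radii_ge tau t0 snu).
have sin1 (y : R) : `|sin y| <= 1 by rewrite sin_cos_shift normr_cos_le1.
(* The exponent 6 is the degree 3 plus the volume exponent 3. *)
have intf tau : (\int[mu3]_xi `|f (xi, tau)|%:E <=
    ((0 <= tau)%R%:R * (C * (rho tau)^-1 ^+ 6))%:E)%E.
  have [tau0|tau0] := leP 0 tau; last first.
    have f0 xi : f (xi, tau) = 0 by rewrite /f/= leNgt tau0 mul0r.
    under eq_integral do rewrite f0 normr0.
    by rewrite integral0 mul0r.
  rewrite mul1r; have [H _] := HCt tau tau0; move: H; rewrite suma; apply: le_trans.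
  apply: ge0_le_integral => //.
  - by apply/measurable_EFinP; rewrite /f/=; mfun; exact: mg1.
  - apply/measurable_EFinP.
    exact: (measurableT_comp (@normr_measurable R setT) (mg1 tau)).
  - move=> xi _; rewrite lee_fin /f/= tau0 mul1r normrM ler_piMr//.
have intf_fin : (@space_measure R \x @lebesgue_measure R)%E.-integrable setT
  (EFin \o f).
  apply/integrable21ltyP; first exact/measurable_EFinP.
  (* Three of the six powers are frozen at [tau = 0], the other three are integrated in [tau]. This
     value serves only to justify Fubini. *)
  apply: le_lt_trans (ltry (C * (rho 0)^-1 ^+ 3 * (2 * (rho 0)^-1))).
  apply: (@le_trans _ _ (\int[lebesgue_measure]_tau
    ((C * (rho 0)^-1 ^+ 3)%:E * ((0 <= tau)%R%:R * (rho tau)^-1 ^+ 3)%:E))%E).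
    apply: ge0_le_integral => //.
    - by move=> tau _; apply: integral_ge0.
    - apply: (@measurable_fun_fubini_tonelli_G _ _ _ _ _ space_measure
        (fun z => `|(f z)%:E|%E)).
      apply: measurableT_comp => //; exact/measurable_EFinP.
    - by [].
    - by apply/measurable_EFinP; rewrite /rho; mfun.
    - move=> tau _; apply: le_trans (intf tau) _; rewrite -EFinM lee_fin.
      have [tau0|] := leP 0 tau; last by rewrite !mul0r mulr0.
      rewrite !mul1r -mulrA ler_wpM2l// (exprD _ 3 3) ler_wpM2r ?exprn_ge0//.
      rewrite lerXn2r ?nnegrE// lef_pV2 ?posrE ?rho_gt0//.
      by rewrite ler_wsqrtr// lerD2l.
  rewrite ge0_integralZl//.
  - rewrite [leRHS]EFinM; apply: lee_wpmul2l.
      by rewrite lee_fin mulr_ge0// exprn_ge0.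
    have := le_integral_rsqrt3_tail (mulr_gt0 t0 s0).
    by rewrite /rho addr0.
  - by apply/measurable_EFinP; rewrite /rho; mfun.
  - by move=> tau _; rewrite lee_fin mulr_ge0// exprn_ge0.
  - by rewrite lee_fin mulr_ge0// exprn_ge0.
pose B (xi : R3 R) : R := monomial3 a xi / dot xi xi * heat_symbol nu t xi *
  sin (dot x xi).
(* Integrating in [tau] first restores the factor 1/|xi|^2. *)
have FE xi : (\int[lebesgue_measure]_tau (f (xi, tau))%:E = (B xi)%:E)%E.
  have [q0|q0] := eqVneq (dot xi xi) 0.
    rewrite /f /g /B/= monomial3_dot0 ?suma//.
    by under eq_integral do rewrite !mul0r mulr0; rewrite integral0 !mul0r.
  have {}q0 : 0 < dot xi xi.
    by rewrite lt_neqAle eq_sym q0/=; apply: sumr_ge0 => l _; exact: sqr_ge0.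
  have E tau : ((f (xi, tau))%:E = (B xi * dot xi xi)%:E *
      ((0 <= tau)%R%:R * expR (- (tau * dot xi xi)))%:E)%E.
    rewrite -EFinM /f /B /g/=; congr EFin; have [tau0|_] := leP 0 tau;
      last by rewrite !mul0r mulr0.
    rewrite (gauss_symbol_radii _ t0 s0)//; field.
    by rewrite gt_eqF.
  under eq_integral do rewrite E.
  rewrite integralZl//.
    by rewrite integral_expR_tail// -EFinM mulfK// gt_eqF.
  apply: (integrable_of_le (c := (dot xi xi)^-1)); first by mfun.
  under eq_integral do rewrite ger0_norm ?mulr_ge0 ?expR_ge0//.
  by rewrite integral_expR_tail.
have iB : mu3.-integrable setT (EFin \o B).
  have := integrable_fubini_F intf_fin.
  by apply: eq_integrable => // xi _; rewrite /fubini_F/= FE.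
split; first exact: iB.
(* In the other order, each fixed [tau] leaves a Gaussian symbol, to which the pointwise Lorentzian
   bound applies. *)
have := Fubini intf_fin; rewrite /fubini_F /fubini_G.
under eq_integral do rewrite FE.
move=> FB.
have -> : \int[mu3]_xi (monomial3 a xi / dot xi xi * heat_symbol nu t xi *
  sin (dot x xi)) =
  fine (\int[lebesgue_measure]_tau \int[mu3]_xi (f (xi, tau))%:E)%E.
  by rewrite /Rintegral; congr fine; exact: FB.
have fineLe (X : \bar R) : (`|fine X|%:E <= `|X|)%E.
  by case: X => [r| |]//=; rewrite normr0 leey.
apply: le_trans (fineLe _) _.
have mG : measurable_fun setT (fun tau => \int[mu3]_xi (f (xi, tau))%:E)%E.
  exact: (measurable_fubini_G intf_fin).
apply: le_trans (le_abse_integral _ _ _) _ => //.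
apply: ge0_le_integral => //.
- exact: measurableT_comp.
- apply/measurable_EFinP; apply: measurable_funM; first by mfun.
  apply: measurable_funM; first by mfun.
  by apply: measurable_fun_lorentz3; [apply: measurable_fun_radii|]; mfun.
move=> tau _.
have iF : mu3.-integrable setT (EFin \o (fun xi => f (xi, tau))).
  apply: integrable_of_le (intf tau).
  by rewrite /f/=; mfun; exact: mg1.
rewrite -[X in (`|X| <= _)%E]fineK; last exact: (integrable_fin_num measurableT iF).
rewrite abse_EFin lee_fin -/(Rintegral _ _ _).
have [tau0|tau0] := leP 0 tau; last first.
  have f0 xi : f (xi, tau) = 0 by rewrite /f/= leNgt tau0 mul0r.
  under eq_Rintegral do rewrite f0.
  by rewrite /Rintegral integral0 normr0 mul0r.
have [_ /(_ x (- (pi / 2)))] := HCt tau tau0; rewrite suma mul1r; apply: le_trans.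
rewrite le_eqVlt; apply/orP; left; apply/eqP; congr `|_|.
apply: eq_Rintegral => xi _.
by rewrite /f/= tau0 mul1r -sin_cos_shift.

Qed.

End leray_kernel.

Section kernel_bounds.
Context {R : realType}.
Implicit Types (nu : R3 R) (i j k : 'I_3) (s t : R).

Lemma measurable_fun_inv_fourier d (T : measurableType d) (a b : T -> R3 R -> R)
    (g : T -> R3 R) :
  measurable_fun setT (fun z : T * R3 R => a z.1 z.2) ->
  measurable_fun setT (fun z : T * R3 R => b z.1 z.2) ->
  measurable_fun setT g ->
  measurable_fun setT (fun z => inv_fourier (a z) (b z) (g z)).
Proof.
move=> ma mb mg; apply: measurable_funM => //.
apply: (@measurable_Rintegral_param _ _ _ _ _ space_measure
  (fun z => a z.1 z.2 * cos (dot (g z.1) z.2) - b z.1 z.2 * sin (dot (g z.1) z.2))).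
have mg1 : measurable_fun setT (fun z : T * R3 R => g z.1).
  exact: measurable_fun_comp_fst.
by mfun.
Qed.

Lemma measurable_fun_heat_symbol d (T : measurableType d) nu (f : T -> R)
    (g : T -> R3 R) :
  measurable_fun setT f -> measurable_fun setT g ->
  measurable_fun setT (fun z => heat_symbol nu (f z) (g z)).
Proof.
move=> mf mg; rewrite /heat_symbol; apply: measurable_fun_expR.
apply: measurable_funM; first by mfun.
by apply: measurable_sum => l; mfun.
Qed.

Lemma measurable_fun_heat_kernel d (T : measurableType d) nu (f : T -> R)
    (g : T -> R3 R) :
  measurable_fun setT f -> measurable_fun setT g ->
  measurable_fun setT (fun z => inv_fourier (heat_symbol nu (f z)) (cst 0) (g z)).
Proof.
move=> mf mg; apply: measurable_fun_inv_fourier => //.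
apply: measurable_fun_heat_symbol; last by mfun.
exact: measurable_fun_comp_fst.
Qed.

Lemma measurable_fun_leray_kernel d (T : measurableType d) nu i j k (f : T -> R)
    (g : T -> R3 R) :
  measurable_fun setT f -> measurable_fun setT g ->
  measurable_fun setT (fun z => heat_leray_div_kernel nu (f z) i j k (g z)).
Proof.
move=> mf mg; apply: measurable_fun_inv_fourier => //.
rewrite /leray_symbol; apply: measurable_funM; first by mfun.
apply: measurable_fun_heat_symbol; last by mfun.
exact: measurable_fun_comp_fst.
Qed.

(** The identity part of the Leray symbol leaves the degree-one symbol xi_k, estimated at [tau = 0];
    the other part is a degree-three monomial over |xi|^2, estimated by subordination. *)
Lemma leray_kernel_pointwise_le : exists2 C : R, 0 <= C & forall nu t s i j k,
  0 < t -> 0 < s -> (forall i, s <= coord3 i nu) -> forall x,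
  (`|heat_leray_div_kernel nu t i j k x|%:E <=
   (C * (Num.sqrt (t * s))^-1 * lorentz3 (radii nu t 0) x)%:E +
   \int[lebesgue_measure]_tau ((0 <= tau)%R%:R *
      (C * (Num.sqrt (t * s + tau))^-1 ^+ 3 * lorentz3 (radii nu t tau) x))%:E)%E.
Proof.
have [C C0 HC] := gauss_symbol_oscillation (R := R).
have [D D0 HD] := subordinated_kernel_le (R := R).
exists (C + D); first exact: addr_ge0.
move=> nu t s i j k t0 s0 snu x.
have rho_gt0 tau : 0 <= tau -> 0 < Num.sqrt (t * s + tau).
  by move=> tau0; rewrite sqrtr_gt0 ltr_wpDr// mulr_gt0.
have L0 tau : 0 <= tau -> 0 <= lorentz3 (radii nu t tau) x.
  by move=> tau0; apply: lorentz3_ge0; exact: (radii_gt0 t0 s0).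
have P0 n tau : 0 <= (Num.sqrt (t * s + tau))^-1 ^+ n.
  by rewrite exprn_ge0// invr_ge0 sqrtr_ge0.
(* The exponents of xi_k xi_i xi_j. The indices may coincide, hence exponents up to 3. *)
pose a l : nat := ((l == k) + ((l == i) + (l == j)))%N.
have suma : (\sum_(l < 3) a l = 3)%N.
  by rewrite !big_split/= !sum_delta.
have a3 l : (a l <= 3)%N by rewrite /a; do 3 case: (_ == _).
have [iB HB] := HD nu t s a t0 s0 snu a3 suma x.
pose A (xi : R3 R) : R := coord3 k xi * heat_symbol nu t xi * sin (dot x xi).
pose B (xi : R3 R) : R := monomial3 a xi / dot xi xi * heat_symbol nu t xi *
  sin (dot x xi).
have aE xi : monomial3 a xi = coord3 k xi * (coord3 i xi * coord3 j xi) :> R.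
  by rewrite /a !monomial3D !monomial3_coord.
have d3 l : ((l == k : nat) <= 3)%N by case: (_ == _).
have [HA1 /(_ x (- (pi / 2)))] := HC (fun l => (l == k) : nat) (radii nu t 0) _
  d3 (rho_gt0 0 (lexx _)) (radii_ge 0 t0 snu).
rewrite sum_delta expr1 => HA.
have gE xi : gauss_symbol (radii nu t 0) xi = heat_symbol nu t xi.
  by rewrite (gauss_symbol_radii _ t0 s0)// mul0r oppr0 expR0 mulr1.
have iA : mu3.-integrable setT (EFin \o A).
  apply: integrableM_le1.
  - by mfun.
  - by move=> xi; rewrite sin_cos_shift normr_cos_le1.
  - apply: (integrable_of_le _ (le_trans _ HA1)).
      apply: measurable_funM; first by mfun.
      by apply: measurable_fun_heat_symbol; mfun.
    by under [leRHS]eq_integral do rewrite monomial3_coord gE.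
have {}HA : `|\int[mu3]_xi A xi| <= C * (Num.sqrt (t * s))^-1 *
  lorentz3 (radii nu t 0) x.
  apply: le_trans (le_trans HA _); last by rewrite addr0.
  rewrite le_eqVlt; apply/orP; left; apply/eqP; congr `|_|.
  by apply: eq_Rintegral => xi _; rewrite monomial3_coord gE -sin_cos_shift.
rewrite /heat_leray_div_kernel /inv_fourier.
(* An odd imaginary symbol enters [inv_fourier] as minus its sine integral, which reverses the signs
   of the two parts. *)
rewrite (_ : Rintegral _ _ _ = \int[mu3]_xi B xi - (i == j)%:R * \int[mu3]_xi A xi);
  last first.
  rewrite -RintegralZl// -RintegralB//.
    apply: eq_Rintegral => xi _; rewrite mul0r /A /B /leray_symbol aE; ring.
  by have := integrableZl measurableT (i == j)%:R iA; apply: eq_integrable.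
have /andP[c0 c1] := inv_2pi_bounds (R := R).
rewrite normrM (ger0_norm c0).
apply: (@le_trans _ _ (`|\int[mu3]_xi A xi|%:E + `|\int[mu3]_xi B xi|%:E)%E).
  rewrite -EFinD lee_fin; apply: le_trans (ler_piMl _ c1) _ => //.
  apply: le_trans (ler_normB _ _) _; rewrite addrC lerD2r normrM.
  by case: (_ == _); rewrite ?normr1 ?mul1r// normr0 mul0r.
apply: leeD.
  rewrite lee_fin; apply: le_trans HA _.
  rewrite -!mulrA ler_wpM2r ?lerDl//; apply: mulr_ge0 (L0 _ (lexx _)).
  by rewrite invr_ge0 sqrtr_ge0.
apply: le_trans HB _; apply: ge0_le_integral => //.
- move=> tau _; rewrite lee_fin; have [tau0|_] := leP 0 tau; last by rewrite mul0r.
  by rewrite mul1r; apply: mulr_ge0 (L0 _ tau0); exact: mulr_ge0 (P0 _ _).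
- apply/measurable_EFinP; apply: measurable_funM; first by mfun.
  apply: measurable_funM; first by mfun.
  by apply: measurable_fun_lorentz3; [apply: measurable_fun_radii|]; mfun.
- apply/measurable_EFinP; apply: measurable_funM; first by mfun.
  apply: measurable_funM; first by mfun.
  by apply: measurable_fun_lorentz3; [apply: measurable_fun_radii|]; mfun.
move=> tau _; rewrite lee_fin; have [tau0|_] := leP 0 tau; last by rewrite !mul0r.
rewrite !mul1r; apply: ler_wpM2r; first exact: L0.
by apply: ler_wpM2r => //; rewrite lerDr.
Qed.

Lemma leray_kernel_le : exists2 C : R, 0 <= C & forall nu t s i j k,
  0 < t -> 0 < s -> (forall i, s <= coord3 i nu) -> forall x,
  (\int[mu3]_y `|heat_leray_div_kernel nu t i j k (x - y)|%:E <=
   (C * (Num.sqrt (t * s))^-1)%:E)%E.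
Proof.
have [C C0 HC] := leray_kernel_pointwise_le.
(* By Tonelli the space integral comes first and gives pi^3 for every [tau]. The first term then
   counts once, and the [tau] integral of the second counts twice. *)
exists (3 * C * pi ^+ 3); first by rewrite !mulr_ge0 ?exprn_ge0 ?pi_ge0.
move=> nu t s i j k t0 s0 snu x.
have L0 tau y : 0 <= tau -> 0 <= lorentz3 (radii nu t tau) y.
  by move=> tau0; apply: lorentz3_ge0; exact: (radii_gt0 t0 s0).
have P0 n tau : 0 <= (Num.sqrt (t * s + tau))^-1 ^+ n.
  by rewrite exprn_ge0// invr_ge0 sqrtr_ge0.
have rho0 : 0 <= (Num.sqrt (t * s))^-1 by rewrite invr_ge0 sqrtr_ge0.
have IL tau : 0 <= tau ->
    (\int[mu3]_y (lorentz3 (radii nu t tau) (x - y))%:E <= (pi ^+ 3)%:E)%E.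
  by move=> tau0; apply: le_integral_lorentz3; exact: (radii_gt0 t0 s0).
pose g (y : R3 R) (tau : R) : R := (0 <= tau)%R%:R *
  (C * (Num.sqrt (t * s + tau))^-1 ^+ 3 * lorentz3 (radii nu t tau) (x - y)).
have g0 y tau : 0 <= g y tau.
  rewrite /g; have [tau0|_] := leP 0 tau; last by rewrite mul0r.
  by rewrite mul1r; apply: mulr_ge0 (L0 _ _ tau0); exact: mulr_ge0 (P0 _ _).
have mg : measurable_fun setT (fun z : R3 R * R => g z.1 z.2).
  rewrite /g; apply: measurable_funM; first by mfun.
  apply: measurable_funM; first by mfun.
  by apply: measurable_fun_lorentz3; [apply: measurable_fun_radii|]; mfun.
have mG : measurable_fun setT (fun y => \int[lebesgue_measure]_tau (g y tau)%:E)%E.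
  apply: (@measurable_fun_fubini_tonelli_F _ _ _ _ _ lebesgue_measure
    (fun z : R3 R * R => (g z.1 z.2)%:E)).
    exact/measurable_EFinP.
  by move=> z; rewrite lee_fin.
have mL tau : measurable_fun setT
    (fun y : R3 R => lorentz3 (radii nu t tau) (x - y)).
  by apply: measurable_fun_lorentz3; mfun.
have CL0 : 0 <= C * (Num.sqrt (t * s))^-1 by exact: mulr_ge0.
apply: (@le_trans _ _ (\int[mu3]_y (
   (C * (Num.sqrt (t * s))^-1 * lorentz3 (radii nu t 0) (x - y))%:E +
   \int[lebesgue_measure]_tau (g y tau)%:E))%E).
  apply: ge0_le_integral => //.
  - apply/measurable_EFinP.
    apply: (measurableT_comp (@normr_measurable R setT)).
    by apply: measurable_fun_leray_kernel; mfun.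
  - apply: emeasurable_funD; last exact: mG.
    by apply/measurable_EFinP; apply: measurable_funM; last exact: mL.
  - by move=> y _; exact: HC.
rewrite ge0_integralD//; last 3 first.
- by move=> y _; rewrite lee_fin mulr_ge0// L0.
- by apply/measurable_EFinP; apply: measurable_funM; last exact: mL.
- by move=> y _; apply: integral_ge0 => tau _; rewrite lee_fin.
rewrite (_ : 3 * C * pi ^+ 3 * (Num.sqrt (t * s))^-1 =
  C * (Num.sqrt (t * s))^-1 * pi ^+ 3 + C * pi ^+ 3 * (2 * (Num.sqrt (t * s))^-1));
    last by ring.
rewrite EFinD; apply: leeD.
  under eq_integral do rewrite EFinM.
  rewrite ge0_integralZl//.
  - by rewrite (EFinM _ (pi ^+ 3)); apply: lee_wpmul2l => //; exact: IL.
  - by apply/measurable_EFinP; exact: mL.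
  - by move=> y _; rewrite lee_fin L0.
have mgE : measurable_fun setT (fun z : R3 R * R => (g z.1 z.2)%:E).
  exact/measurable_EFinP.
have FT : (\int[mu3]_y \int[lebesgue_measure]_tau (g y tau)%:E =
    \int[lebesgue_measure]_tau \int[mu3]_y (g y tau)%:E)%E.
  apply: (@fubini_tonelli _ _ _ _ _ space_measure lebesgue_measure _ mgE).
  by move=> z; rewrite lee_fin.
rewrite FT.
apply: (@le_trans _ _ (\int[lebesgue_measure]_tau
  ((C * pi ^+ 3)%:E * ((0 <= tau)%R%:R * (Num.sqrt (t * s + tau))^-1 ^+ 3)%:E))%E).
  apply: ge0_le_integral => //.
  - by move=> tau _; apply: integral_ge0 => y _; rewrite lee_fin.
  - apply: (@measurable_fun_fubini_tonelli_G _ _ _ _ _ space_measure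
      (fun z : R3 R * R => (g z.1 z.2)%:E)).
      exact/measurable_EFinP.
    by move=> z; rewrite lee_fin.
  - by apply/measurable_EFinP; mfun.
  move=> tau _; rewrite /g; have [tau0|_] := leP 0 tau; last first.
    under eq_integral do rewrite mul0r.
    by rewrite integral0 mul0r mule0.
  under eq_integral do rewrite mul1r EFinM.
  rewrite ge0_integralZl//.
  - rewrite mul1r -EFinM (mulrAC C) (EFinM _ (pi ^+ 3)); apply: lee_wpmul2l;
      last exact: IL.
    by rewrite lee_fin; exact: mulr_ge0.
  - by apply/measurable_EFinP; exact: mL.
  - by move=> y _; rewrite lee_fin L0.
  - by rewrite lee_fin; exact: mulr_ge0.
rewrite ge0_integralZl//.
- rewrite (EFinM (C * _)); apply: lee_wpmul2l.
    by rewrite lee_fin mulr_ge0// exprn_ge0// pi_ge0.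
  exact/le_integral_rsqrt3_tail/mulr_gt0.
- by apply/measurable_EFinP; mfun.
- by rewrite lee_fin mulr_ge0// exprn_ge0// pi_ge0.
Qed.

End kernel_bounds.

(** * Spreading of the heat flow in the first variable *)

Section heat_flow.
Context {R : realType}.
Implicit Types (nu : R3 R) (s t : R).

Lemma integral_strip_le (M c : R) : 0 <= M -> 0 <= c ->
  (\int[lebesgue_measure]_y (c * (`|y| <= M)%R%:R)%:E <= (c * (2 * M))%:E)%E.
Proof.
move=> M0 c0; under eq_integral do rewrite EFinM.
have mi : measurable_fun setT (fun y : R => (`|y| <= M)%R%:R : R) by mfun.
rewrite ge0_integralZl//; last exact/measurable_EFinP.
rewrite EFinM; apply: lee_wpmul2l; first by rewrite lee_fin.
rewrite (_ : (fun y => _) = fun y : R => (\1_(`[- M, M]%classic) y)%:E); last first.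
  by apply/funext => y; rewrite indicE mem_setE in_itv/= ler_norml.
rewrite integral_indic// setIT.
change (lebesgue_measure [set` `[- M, M]%R] <= (2 * M)%:E)%E.
rewrite lebesgue_measure_itv/= lte_fin; case: ifP => _;
  last by rewrite lee_fin mulr_ge0.
by rewrite -EFinB lee_fin; lra.
Qed.

(** The part of size [e] is bounded by the mass of the kernel. On the strip the Lorentzian in the
    first variable is replaced by its maximum (t nu1)^(-1/2) and integrated over a length [2 * M].
    With [A = M = 0] this is the plain sup bound. *)
Lemma heat_le : exists2 C : R, 0 <= C & forall nu t s (f : R3 R -> R) (e A M : R) x,
  0 < t -> 0 < s -> (forall i, s <= coord3 i nu) ->
  measurable_fun setT f -> 0 <= e -> 0 <= A -> 0 <= M ->
  {ae mu3, forall y, `|f y| <= e + A * (`|coord3 0 y| <= M)%R%:R} ->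
  `|heat nu t f x| <= C * (e + A * M * (Num.sqrt (t * coord3 0 nu))^-1).
Proof.
have [C C0 HC] := heat_kernel_le (R := R).
have pi0 : 0 <= pi :> R := pi_ge0 R.
(* pi^3 is the mass of [lorentz3]; 2 pi^2 comes from the width of the strip and the masses in the
   two other variables. *)
exists (C * (pi ^+ 3 + 2 * pi ^+ 2)).
  exact: mulr_ge0 C0 (addr_ge0 (exprn_ge0 _ pi0)
    (mulr_ge0 (ler0n _ _) (exprn_ge0 _ pi0))).
move=> nu t s f e A M x t0 s0 snu mf e0 A0 M0 fe.
rewrite /heat gt_eqF// /convolution.
pose r := radii nu t 0.
have r0 i : 0 < coord3 i r by exact: (radii_gt0 t0 s0).
have L0 i y : 0 <= lorentz (coord3 i r)^-1 (coord3 i x - y).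
  by rewrite lorentz_ge0// invr_ge0 ltW.
have mk : measurable_fun setT
    (fun y : R3 R => inv_fourier (heat_symbol nu t) (cst 0) (x - y)).
  by apply: measurable_fun_heat_kernel; mfun.
have mL : measurable_fun setT (fun y : R3 R => lorentz3 r (x - y)).
  by apply: measurable_fun_lorentz3; mfun.
apply: normr_Rintegral_le; first exact: measurable_funM.
pose g (y : R3 R) : R := (coord3 0 r)^-1 * (`|coord3 0 y| <= M)%R%:R *
  lorentz (coord3 1 r)^-1 (coord3 1 x - coord3 1 y) *
  lorentz (coord3 2 r)^-1 (coord3 2 x - coord3 2 y).
have mg : measurable_fun setT g by rewrite /g; mfun.
have g0 y : 0 <= g y.
  by rewrite /g; do 2 (apply: mulr_ge0 => //); apply: mulr_ge0 => //;
    rewrite invr_ge0 ltW.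
have Ig : (\int[mu3]_y (g y)%:E <= ((coord3 0 r)^-1 * (2 * M) * pi * pi)%:E)%E.
  have LI i : (\int[lebesgue_measure]_y
      (lorentz (coord3 i r)^-1 (coord3 i x - y))%:E <= (pi : R)%:E)%E.
    by apply: le_integral_lorentz; rewrite invr_gt0.
  have mLi i : measurable_fun setT
    (fun y : R => lorentz (coord3 i r)^-1 (coord3 i x - y)) by mfun.
  have r00 : 0 <= (coord3 0 r)^-1 by rewrite invr_ge0 ltW.
  have ms : measurable_fun setT
    (fun y : R => (coord3 0 r)^-1 * (`|y| <= M)%R%:R) by mfun.
  have h1 := @le_integral_prod _ _ _ _ R lebesgue_measure lebesgue_measure
    _ _ _ _ ms (mLi 1) (fun y => mulr_ge0 r00 (ler0n _ _)) (L0 1)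
    (integral_strip_le M0 r00) (LI 1).
  apply: (@le_integral_prod _ _ _ _ R plane_measure lebesgue_measure
    _ _ _ _ _ (mLi 2) _ (L0 2) h1 (LI 2)).
  - by mfun.
  - by move=> z; apply: mulr_ge0 => //; apply: mulr_ge0.
have gL y : lorentz3 r (x - y) * (`|coord3 0 y| <= M)%R%:R <= g y.
  rewrite /g /lorentz3 !coord3B.
  rewrite (mulrAC _ _ (_ <= _)%R%:R) (mulrAC _ _ (_ <= _)%R%:R).
  do 3 (apply: ler_wpM2r => //).
  by apply: lorentz_le; rewrite invr_ge0 ltW.
have CA0 : 0 <= C * A by exact: mulr_ge0.
have Ce0 : 0 <= C * e by exact: mulr_ge0.
have L3 y : 0 <= lorentz3 r (x - y) by exact: lorentz3_ge0.
apply: (@le_trans _ _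
  (\int[mu3]_y ((C * e * lorentz3 r (x - y))%:E + (C * A * g y)%:E))%E).
  apply: ae_ge0_le_integral => //.
  - apply/measurable_EFinP; apply: (measurableT_comp (@normr_measurable R setT)).
    exact: measurable_funM.
  - by move=> y _; rewrite -EFinD lee_fin addr_ge0// mulr_ge0.
  - by apply: emeasurable_funD; apply/measurable_EFinP; apply: measurable_funM.
  - have [N [mN N0 HN]] := fe; exists N; split => // y /= nP.
    apply: HN => /= fy; apply: nP => _.
    rewrite -EFinD lee_fin normrM.
    apply: le_trans (ler_pM _ _ (HC nu t s t0 s0 snu (x - y)) fy) _ => //.
    rewrite -/r mulrDr mulrAC lerD2l.
    rewrite (_ : _ * _ * (A * _) = C * A *
      (lorentz3 r (x - y) * (`|coord3 0 y| <= M)%R%:R)); last by ring.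
    exact: ler_wpM2l.
rewrite ge0_integralD//; last 4 first.
- by move=> y _; rewrite lee_fin; exact: mulr_ge0.
- by apply/measurable_EFinP; apply: measurable_funM; last exact: mL.
- by move=> y _; rewrite lee_fin; exact: mulr_ge0.
- by apply/measurable_EFinP; apply: measurable_funM; last exact: mg.
apply: (@le_trans _ _ ((C * e * pi ^+ 3)%:E +
    (C * A * ((coord3 0 r)^-1 * (2 * M) * pi * pi))%:E)%E).
  apply: leeD.
  - under eq_integral do rewrite EFinM.
    rewrite ge0_integralZl//.
    + rewrite (EFinM (C * e)); apply: lee_wpmul2l => //.
      exact: le_integral_lorentz3.
    + by apply/measurable_EFinP; exact: mL.
    + by move=> y _; rewrite lee_fin.
  - under eq_integral do rewrite EFinM.
    rewrite ge0_integralZl//.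
    + by rewrite (EFinM (C * A)); apply: lee_wpmul2l.
    + by apply/measurable_EFinP; exact: mg.
    + by move=> y _; rewrite lee_fin.
rewrite -EFinD lee_fin coord3_radii addr0.
set ri := (Num.sqrt _)^-1; have ri0 : 0 <= ri by rewrite invr_ge0 sqrtr_ge0.
have h1 : 0 <= C * (pi ^+ 3 * (A * M * ri)).
  by apply: mulr_ge0 => //; apply: mulr_ge0; rewrite ?exprn_ge0 ?mulr_ge0.
have h2 : 0 <= C * (pi ^+ 2 * e) by apply: mulr_ge0 => //; rewrite mulr_ge0 ?exprn_ge0.
rewrite -subr_ge0 (_ : _ - _ = C * (pi ^+ 3 * (A * M * ri)) + 2 * (C * (pi ^+ 2 * e))).
  by rewrite addr_ge0// mulr_ge0.
by ring.
Qed.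

End heat_flow.

(** * Duhamel operator and Picard iteration *)

Section duhamel.
Context {R : realType}.
Variables (nu : R3 R) (C : R).
Hypothesis C_ge0 : 0 <= C.
Hypothesis kernel_le : forall t i j k x, 0 < t ->
  (\int[mu3]_y `|heat_leray_div_kernel nu t i j k (x - y)|%:E <=
   (C * (Num.sqrt t)^-1)%:E)%E.
Implicit Types (F G : 'I_3 -> 'I_3 -> R -> R3 R -> R) (f : R3 R -> R) (t : R).

Let convolution_kernel_le f (W : R) t i j k x : 0 < t ->
  measurable_fun setT f -> (forall y, `|f y| <= W) ->
  (\int[mu3]_y `|heat_leray_div_kernel nu t i j k (x - y) * f y|%:E <=
   (C * (Num.sqrt t)^-1 * W)%:E)%E.
Proof.
move=> t0 mf fW.
have W0 : 0 <= W by apply: le_trans (fW 0); exact: normr_ge0.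
have mk : measurable_fun setT (fun y : R3 R =>
  heat_leray_div_kernel nu t i j k (x - y)).
  by apply: measurable_fun_leray_kernel; mfun.
have mn : measurable_fun setT
    (fun y : R3 R => `|heat_leray_div_kernel nu t i j k (x - y)|).
  exact: (measurableT_comp (@normr_measurable R setT) mk).
apply: (@le_trans _ _ (\int[mu3]_y
    (`|heat_leray_div_kernel nu t i j k (x - y)|%:E * W%:E))%E).
  apply: ge0_le_integral => //.
  - apply/measurable_EFinP; apply: (measurableT_comp (@normr_measurable R setT)).
    exact: measurable_funM.
  - by under eq_fun do rewrite -EFinM; apply/measurable_EFinP;
      apply: measurable_funM; first exact: mn.
  - by move=> y _; rewrite -EFinM lee_fin normrM ler_wpM2l.
rewrite ge0_integralZr//; last by apply/measurable_EFinP; exact: mn.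
by rewrite (EFinM (C * _)); apply: lee_wpmul2r => //; exact: kernel_le.
Qed.

Let measurable_kernel_mul f t i j k x : measurable_fun setT f ->
  measurable_fun setT (fun y : R3 R => heat_leray_div_kernel nu t i j k (x - y) * f y).
Proof.
move=> mf; apply: measurable_funM => //.
by apply: measurable_fun_leray_kernel; mfun.
Qed.

Lemma heat_leray_div_le (H : 'I_3 -> 'I_3 -> R3 R -> R) (W : R) t i x : 0 < t ->
  (forall j k, measurable_fun setT (H j k)) -> (forall j k y, `|H j k y| <= W) ->
  `|heat_leray_div nu t H i x| <= 9 * C * (Num.sqrt t)^-1 * W.
Proof.
move=> t0 mH HW; apply:
  (@le_trans _ _ (\sum_(j < 3) \sum_(k < 3) (C * (Num.sqrt t)^-1 * W))).
  apply: le_trans (ler_norm_sum _ _ _) _; apply: ler_sum => j _.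
  apply: le_trans (ler_norm_sum _ _ _) _; apply: ler_sum => k _.
  apply: normr_Rintegral_le; first exact: measurable_kernel_mul.
  exact: convolution_kernel_le.
by rewrite !sum3E; lra.
Qed.

Lemma heat_leray_divB (H H' : 'I_3 -> 'I_3 -> R3 R -> R) (W : R) t i x : 0 < t ->
  (forall j k, measurable_fun setT (H j k)) -> (forall j k y, `|H j k y| <= W) ->
  (forall j k, measurable_fun setT (H' j k)) -> (forall j k y, `|H' j k y| <= W) ->
  heat_leray_div nu t H i x - heat_leray_div nu t H' i x =
  heat_leray_div nu t (fun j k y => H j k y - H' j k y) i x.
Proof.
move=> t0 mH HW mH' HW'; rewrite /heat_leray_div -sumrB; apply: eq_bigr => j _.
rewrite -sumrB; apply: eq_bigr => k _; rewrite /convolution -RintegralB//.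
- by apply: eq_Rintegral => y _; rewrite mulrBr.
- apply: integrable_of_le (convolution_kernel_le _ _ _ _ t0 (mH j k) (HW j k)).
  exact: measurable_kernel_mul.
- apply: integrable_of_le (convolution_kernel_le _ _ _ _ t0 (mH' j k) (HW' j k)).
  exact: measurable_kernel_mul.
Qed.

Definition duhamel F i t (x : R3 R) : R :=
  \int[lebesgue_measure]_(s in `[0, t]) heat_leray_div nu (t - s)
    (fun j k => F j k s) i x.

Definition joint_measurable (u : R -> R3 R -> R) :=
  measurable_fun setT (fun z : R * R3 R => u z.1 z.2).

Lemma joint_measurable_slice (u : R -> R3 R -> R) t :
  joint_measurable u -> measurable_fun setT (u t).
Proof.
move=> mf; apply: (measurableT_comp mf (g := fun y => (t, y))).
by apply: measurable_fun_pair; [exact: measurable_cst|exact: measurable_id].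
Qed.

Lemma measurable_fun_heat_leray_div d (T : measurableType d) F i (a b : T -> R)
    (g : T -> R3 R) :
  (forall j k, joint_measurable (F j k)) ->
  measurable_fun setT a -> measurable_fun setT b -> measurable_fun setT g ->
  measurable_fun setT (fun z =>
    heat_leray_div nu (a z) (fun j k => F j k (b z)) i (g z)).
Proof.
move=> mF ma mb mg; apply: measurable_sum => j; apply: measurable_sum => k.
apply: (@measurable_Rintegral_param _ _ _ _ _ space_measure (fun z =>
   heat_leray_div_kernel nu (a z.1) i j k (g z.1 - z.2) * F j k (b z.1) z.2)).
apply: measurable_funM.
  apply: measurable_fun_leray_kernel; first exact: measurable_fun_comp_fst.
  by apply: measurable_fun_subR3;
    [exact: measurable_fun_comp_fst|exact: measurable_snd].
apply: (measurableT_comp (mF j k) (g := fun z : T * R3 R => (b z.1, z.2))).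
by apply: measurable_fun_pair; [exact: measurable_fun_comp_fst|exact: measurable_snd].
Qed.

Lemma joint_measurable_duhamel F i :
  (forall j k, joint_measurable (F j k)) -> joint_measurable (duhamel F i).
Proof.
move=> mF; rewrite /joint_measurable /duhamel.
under eq_fun do rewrite Rintegral_mkcond.
apply: (@measurable_Rintegral_param _ _ _ _ _ lebesgue_measure
  (fun z : (R * R3 R) * R => ((fun s => heat_leray_div nu (z.1.1 - s)
     (fun j k => F j k s) i z.1.2) \_ `[0, z.1.1]) z.2)).
(* The moving interval of integration becomes a product of two indicators, jointly measurable in
   both times. *)
rewrite (_ : (fun _ => _) = fun z : (R * R3 R) * R =>
    (0 <= z.2)%R%:R * (z.2 <= z.1.1)%R%:R *
    heat_leray_div nu (z.1.1 - z.2) (fun j k => F j k z.2) i z.1.2); last first.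
  apply/funext => z; rewrite /patch mem_setE in_itv/=.
  by case: (0 <= z.2); case: (z.2 <= z.1.1); rewrite ?mul1r ?mul0r.
apply: measurable_funM; first by mfun.
by apply: measurable_fun_heat_leray_div; mfun.
Qed.

Let measurable_integrand F i t x : (forall j k, joint_measurable (F j k)) ->
  measurable_fun setT (fun s : R => heat_leray_div nu (t - s) (fun j k => F j k s) i x).
Proof. by move=> mF; apply: measurable_fun_heat_leray_div; mfun. Qed.

(** At [s = t] the kernel is evaluated at time 0, where no bound holds; that endpoint is a null
    set. *)
Let duhamelE F i t x : (forall j k, joint_measurable (F j k)) ->
  duhamel F i t x = \int[lebesgue_measure]_(s in `[0, t[)
    heat_leray_div nu (t - s) (fun j k => F j k s) i x.
Proof.
move=> mF; rewrite /duhamel /Rintegral integral_itv_bndo_bndc//.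
apply: measurable_funTS; apply/measurable_EFinP; exact: measurable_integrand.
Qed.

Let integrand_le F i t x (e a b : R) : 0 <= t -> 0 <= e -> 0 <= a -> 0 <= b ->
  (forall j k, joint_measurable (F j k)) ->
  (forall j k s y, 0 <= s < t -> `|F j k s y| <= a * (s < e)%R%:R + b) ->
  (\int[lebesgue_measure]_(s in `[0%R, t[)
     `|heat_leray_div nu (t - s) (fun j k => F j k s) i x|%:E <=
   (9 * C * (2 * a * Num.sqrt e + 2 * b * Num.sqrt t))%:E)%E.
Proof.
move=> t0 e0 a0 b0 mF Fw.
pose w (s : R) : R := (Num.sqrt (t - s))^-1 * (a * (s < e)%R%:R + b).
have w0 s : 0 <= w s.
  by rewrite mulr_ge0 ?invr_ge0 ?sqrtr_ge0// addr_ge0// mulr_ge0.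
have mw : measurable_fun setT w.
  rewrite (_ : w = fun s => (Num.sqrt (t - s))^-1 * (a * (1 - (e <= s)%R%:R) + b)).
    by mfun.
  by apply/funext => s; rewrite /w; case: leP => _; rewrite ?subrr ?subr0.
have C9 : 0 <= 9 * C by rewrite mulr_ge0.
have mw' : measurable_fun setT (fun s => (9 * C * w s)%:E).
  by apply/measurable_EFinP; apply: measurable_funM.
apply: (@le_trans _ _ (\int[lebesgue_measure]_(s in `[0%R, t[) (9 * C * w s)%:E)%E).
  apply: ge0_le_integral => //.
  - apply: measurable_funTS; apply/measurable_EFinP.
    by apply: (measurableT_comp (@normr_measurable R setT));
      exact: measurable_integrand.
  - exact: measurable_funTS mw'.
  - move=> s; rewrite /= in_itv/= => /andP[s0 st]; rewrite lee_fin.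
    rewrite /w mulrA; apply: heat_leray_div_le; first by rewrite subr_gt0.
      by move=> j k; exact: joint_measurable_slice.
    by move=> j k y; apply: Fw; rewrite s0.
apply: (@le_trans _ _ (\int[lebesgue_measure]_(s in `[0%R, t]) (9 * C * w s)%:E)%E).
  apply: ge0_subset_integral => //.
  - exact: measurable_funTS mw'.
  - by move=> s _; rewrite lee_fin mulr_ge0.
  - by apply: subset_itvl; rewrite bnd_simp.
under eq_integral do rewrite EFinM.
rewrite ge0_integralZl//.
- by rewrite (EFinM (9 * C)); apply: lee_wpmul2l => //; exact: le_integral_rsqrt_step.
- by apply: measurable_funTS; apply/measurable_EFinP.
- by move=> s _; rewrite lee_fin.
Qed.

Lemma duhamel_le F i t x (e a b : R) : 0 <= t -> 0 <= e -> 0 <= a -> 0 <= b ->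
  (forall j k, joint_measurable (F j k)) ->
  (forall j k s y, 0 <= s < t -> `|F j k s y| <= a * (s < e)%R%:R + b) ->
  `|duhamel F i t x| <= 9 * C * (2 * a * Num.sqrt e + 2 * b * Num.sqrt t).
Proof.
move=> t0 e0 a0 b0 mF Fw; rewrite duhamelE// Rintegral_mkcond.
apply: normr_Rintegral_le.
  apply/(measurable_restrictT _ _).1 => //.
  by apply: measurable_funTS; exact: measurable_integrand.
apply: le_trans (integrand_le i x t0 e0 a0 b0 mF Fw).
rewrite [leRHS]integral_mkcond le_eqVlt; apply/orP; left; apply/eqP.
by apply: eq_integral => s _; rewrite /patch; case: ifP; rewrite ?normr0.
Qed.

(** Boundedness of both sources provides the integrability, in space and in time, that additivity of
    the integral requires. *)
Lemma duhamelB F G i t x (W : R) : 0 <= t -> 0 <= W ->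
  (forall j k, joint_measurable (F j k)) ->
  (forall j k, joint_measurable (G j k)) ->
  (forall j k s y, 0 <= s < t -> `|F j k s y| <= W) ->
  (forall j k s y, 0 <= s < t -> `|G j k s y| <= W) ->
  duhamel F i t x - duhamel G i t x =
  duhamel (fun j k s y => F j k s y - G j k s y) i t x.
Proof.
move=> t0 W0 mF mG FW GW.
have mFG j k : joint_measurable (fun s y => F j k s y - G j k s y).
  exact: measurable_funB (mF j k) (mG j k).
have ii H : (forall j k, joint_measurable (H j k)) ->
    (forall j k s y, 0 <= s < t -> `|H j k s y| <= W) ->
    lebesgue_measure.-integrable `[0, t[ (EFin \o
      (fun s => heat_leray_div nu (t - s) (fun j k => H j k s) i x)).
  move=> mH HW; apply/integrableP; split.
    apply: measurable_funTS; apply/measurable_EFinP; exact: measurable_integrand.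
  apply: le_lt_trans (integrand_le i x t0 (lexx 0) (lexx 0) W0 mH _) (ltry _).
  by move=> j k s y st; rewrite mul0r add0r HW.
rewrite !duhamelE// -RintegralB//; [|exact: ii|exact: ii].
apply: eq_Rintegral => s; rewrite inE/= in_itv/= => /andP[s0 st].
apply: (@heat_leray_divB _ _ W); first by rewrite subr_gt0.
- by move=> j k; exact: joint_measurable_slice.
- by move=> j k y; apply: FW; rewrite s0.
- by move=> j k; exact: joint_measurable_slice.
- by move=> j k y; apply: GW; rewrite s0.
Qed.

End duhamel.

Section geometric_limits.
Context {R : realType}.

Lemma cvg_half_pow (c : R) : c * 2^-1 ^+ n @[n --> \oo] --> 0.
Proof.
by apply: (@cvg_geometric R c 2^-1); rewrite ger0_norm ?invr_ge0// invf_lt1// ltr1n.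
Qed.

Lemma ler_half_pow (x y c : R) : (forall n, x <= y + c * 2^-1 ^+ n) -> x <= y.
Proof.
move=> H; have cv : y + c * 2^-1 ^+ n @[n --> \oo] --> y.
  by rewrite -[X in _ --> X]addr0; apply: cvgD; [exact: cvg_cst|exact: cvg_half_pow].
rewrite -(cvg_lim _ cv)//; apply: limr_ge; first exact: cvgP cv.
exact: nearW.
Qed.

(** Shifting [a n] down, respectively up, by [2 * d * 2^-1 ^+ n] gives a nondecreasing and a
    nonincreasing sequence. Their common limit is enclosed between them, which yields convergence
    and rate together. *)
Lemma geometric_limit (a : nat -> R) (d : R) :
  (forall n, `|a n.+1 - a n| <= d * 2^-1 ^+ n) ->
  exists2 l, a n @[n --> \oo] --> l & forall n, `|l - a n| <= 2 * d * 2^-1 ^+ n.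
Proof.
move=> H; pose b n := a n - 2 * d * 2^-1 ^+ n; pose c n := a n + 2 * d * 2^-1 ^+ n.
have half n : 2^-1 ^+ n.+1 = 2^-1 * 2^-1 ^+ n :> R by exact: exprS.
have nb : nondecreasing_seq b.
  apply/nondecreasing_seqP => n; rewrite /b half.
  by have := H n; rewrite ler_norml => /andP[]; lra.
have nc : nonincreasing_seq c.
  apply/nonincreasing_seqP => n; rewrite /c half.
  by have := H n; rewrite ler_norml => /andP[]; lra.
have d0 : 0 <= d by have := H 0%N; rewrite expr0 mulr1; apply: le_trans.
have bc n : b n <= c n.
  rewrite /b /c; have : 0 <= d * 2^-1 ^+ n by rewrite mulr_ge0// exprn_ge0.
  lra.
have cvb : cvgn b.
  apply: nondecreasing_is_cvgn => //; exists (c 0%N) => _ [n _ <-].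
  by apply: le_trans (bc n) _; exact: nc.
have cva : a n @[n --> \oo] --> limn b.
  have -> : a = fun n => b n + 2 * d * 2^-1 ^+ n.
    by apply/funext => n; rewrite /b subrK.
  rewrite -[X in _ --> X]addr0; apply: cvgD; first exact: cvb.
  exact: cvg_half_pow.
exists (limn b) => // n.
have h1 : b n <= limn b by exact: nondecreasing_cvgn_le.
have cvc : c n @[n --> \oo] --> limn b.
  rewrite -[X in _ --> X]addr0; apply: cvgD; first exact: cva.
  exact: cvg_half_pow.
have h2 : limn b <= c n.
  by rewrite -(cvg_lim _ cvc)//; apply: nonincreasing_cvgn_ge => //; apply/cvg_ex;
    exists (limn b).
by rewrite ler_norml; move: h1 h2; rewrite /b /c; lra.
Qed.

End geometric_limits.

Section picard.
Context {R : realType}.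
Variables (nu : R3 R) (C : R).
Hypothesis C_ge0 : 0 <= C.
Hypothesis kernel_le : forall t i j k x, 0 < t ->
  (\int[mu3]_y `|heat_leray_div_kernel nu t i j k (x - y)|%:E <=
   (C * (Num.sqrt t)^-1)%:E)%E.
Variables (T A h e : R) (F0 : 'I_3 -> R -> R3 R -> R).
Hypotheses (e_ge0 : 0 <= e) (h_ge0 : 0 <= h) (h_le : h <= A).
Hypothesis F0_measurable : forall i, joint_measurable (F0 i).
Hypothesis F0_le : forall i t x, 0 <= t < T -> `|F0 i t x| <= A * (t < e)%R%:R + h.
(** [16 * A ^+ 2] and [4 * h ^+ 2] bound the squared weight of the ball before and after [e], using
    [h <= A]. In the Lipschitz condition, [4 * A] and [4 * h] are the coefficients of twice the
    weight. *)
Hypothesis small_ball :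
  9 * C * (2 * (16 * A ^+ 2) * Num.sqrt e + 2 * (4 * h ^+ 2) * Num.sqrt T) <= h.
Hypothesis small_lipschitz :
  9 * C * (2 * (4 * A) * Num.sqrt e + 2 * (4 * h) * Num.sqrt T) <= 2^-1.

Local Notation field := ('I_3 -> R -> R3 R -> R).

Let A_ge0 : 0 <= A. Proof. exact: le_trans h_le. Qed.

Let quad (u : field) j k s y := u j s y * u k s y.

Let weight (t : R) : R := 2 * A * (t < e)%R%:R + 2 * h.

Let ball (u : field) := (forall i, joint_measurable (u i)) /\
  forall i t x, `|u i t x| <= weight t.

(** The Duhamel map, set to 0 outside [0, T) so that the bounds defining the ball and the sup
    distance hold at all real times. The cut-off is a product of indicators to keep joint
    measurability. *)
Let Phi (u : field) : field := fun i t x =>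
  (0 <= t)%R%:R * (1 - (T <= t)%R%:R) * (F0 i t x - duhamel nu (quad u) i t x).

Let PhiE u i t x : 0 <= t < T -> Phi u i t x = F0 i t x - duhamel nu (quad u) i t x.
Proof. by case/andP=> t0 tT; rewrite /Phi t0 leNgt tT subr0 !mul1r. Qed.

Let PhiE0 u i t x : ~~ (0 <= t < T) -> Phi u i t x = 0.
Proof.
rewrite /Phi; case: (leP 0 t) => //= _; last by rewrite !mul0r.
by rewrite -leNgt => ->; rewrite subrr mulr0 mul0r.
Qed.

Let quad_measurable u : (forall i, joint_measurable (u i)) ->
  forall j k, joint_measurable (quad u j k).
Proof. by move=> mu j k; exact: measurable_funM (mu j) (mu k). Qed.

Let weight_ge0 t : 0 <= weight t.
Proof. by rewrite /weight addr_ge0// !mulr_ge0. Qed.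

Let quad_le u : ball u -> forall j k s y,
  `|quad u j k s y| <= 16 * A ^+ 2 * (s < e)%R%:R + 4 * h ^+ 2.
Proof.
move=> [_ ub] j k s y; rewrite normrM.
apply: le_trans (ler_pM _ _ (ub j s y) (ub k s y)) _ => //.
rewrite /weight; case: ltP => _; rewrite ?mulr1 ?mulr0 ?add0r; last by lra.
by have := ler_wpM2r A_ge0 h_le; have := sqr_ge0 A; rewrite !expr2; lra.
Qed.

Let duhamel_quad_le u i t x : ball u -> 0 <= t < T ->
  `|duhamel nu (quad u) i t x| <= h.
Proof.
move=> [um ub] /andP[t0 tT]; apply: le_trans small_ball.
apply: le_trans (duhamel_le C_ge0 kernel_le i x t0 e_ge0 _ _
  (quad_measurable um) (fun j k s y _ => quad_le (conj um ub) j k s y)) _.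
- by rewrite mulr_ge0// sqr_ge0.
- by rewrite mulr_ge0// sqr_ge0.
- by rewrite ler_wpM2l ?mulr_ge0// lerD2l ler_wpM2l ?mulr_ge0 ?sqr_ge0//
    ler_wsqrtr// ltW.
Qed.

Let ball_Phi u : ball u -> ball (Phi u).
Proof.
move=> bu; have [um ub] := bu; split.
  move=> i; rewrite /joint_measurable /Phi.
  have h1 := F0_measurable i.
  have h2 := joint_measurable_duhamel nu i (quad_measurable um).
  by apply: measurable_funM; [mfun|exact: measurable_funB].
move=> i t x; have [tT|tT] := boolP (0 <= t < T); last by rewrite PhiE0// normr0.
rewrite PhiE//; apply: le_trans (ler_normB _ _) _.
have := F0_le i x tT; have := duhamel_quad_le i x bu tT.
have := A_ge0.
rewrite /weight; case: ltP => _; rewrite ?mulr1 ?mulr0; lra.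
Qed.

Let Phi_contraction u v (d : R) : ball u -> ball v -> 0 <= d ->
  (forall i t x, `|u i t x - v i t x| <= d) ->
  forall i t x, `|Phi u i t x - Phi v i t x| <= d * 2^-1.
Proof.
move=> bu bv d0 uv i t x.
have [tT|tT] := boolP (0 <= t < T); last first.
  by rewrite !PhiE0// subrr normr0 mulr_ge0.
have [um ub] := bu; have [vm vb] := bv.
have sub (p q r : R) : p - q - (p - r) = - (q - r) by ring.
rewrite !PhiE// sub normrN; have /andP[t0 tT'] := tT.
have W w : ball w -> forall j k s y, 0 <= s < t ->
  `|quad w j k s y| <= 16 * A ^+ 2 + 4 * h ^+ 2.
  move=> bw j k s y _; apply: le_trans (quad_le bw j k s y) _; rewrite lerD2r.
  by rewrite ler_piMr ?mulr_ge0 ?sqr_ge0// lern1 leq_b1.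
rewrite (duhamelB C_ge0 kernel_le i x t0 _ (quad_measurable um) (quad_measurable vm)
  (W _ bu) (W _ bv)); last by rewrite addr_ge0// mulr_ge0 ?sqr_ge0.
apply: le_trans (duhamel_le C_ge0 kernel_le (a := 4 * A * d) (b := 4 * h * d) i x t0
  e_ge0 _ _ _ _) _.
- by rewrite !mulr_ge0.
- by rewrite !mulr_ge0.
- by move=> j k; exact: measurable_funB (quad_measurable um j k)
    (quad_measurable vm j k).
- move=> j k s y _.
  rewrite (_ : _ - _ = u j s y * (u k s y - v k s y) + (u j s y - v j s y) *
    v k s y); last first.
    by rewrite /quad; ring.
  apply: le_trans (ler_normD _ _) _; rewrite !normrM.
  apply: (@le_trans _ _ (weight s * d + d * weight s)).
    by apply: lerD; apply: ler_pM.
  by rewrite /weight; lra.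
- apply: (@le_trans _ _
    (9 * C * (2 * (4 * A) * Num.sqrt e + 2 * (4 * h) * Num.sqrt T) * d)).
    rewrite -(mulrA (9 * C) _ d) ler_wpM2l ?mulr_ge0//.
    have sT : Num.sqrt t <= Num.sqrt T by rewrite ler_wsqrtr// ltW.
    by have := ler_wpM2l (mulr_ge0 h_ge0 d0) sT; lra.
  by rewrite mulrC ler_wpM2l.
Qed.

Lemma picard_fixed_point : exists u : field,
  [/\ forall i, joint_measurable (u i),
      forall i t x, `|u i t x| <= 2 * A + 2 * h &
      forall i t x, 0 <= t < T ->
        u i t x = F0 i t x - duhamel nu (fun j k s y => u j s y * u k s y) i t x].
Proof.
pose U n := iter n Phi (fun _ _ _ => 0).
have bU n : ball (U n).
  elim: n => [|n IH]; last exact: ball_Phi.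
  by split=> [i|i t x]; [exact: measurable_cst|rewrite normr0].
have wM t : weight t <= 2 * A + 2 * h.
  by rewrite /weight lerD2r ler_piMr ?mulr_ge0// lern1 leq_b1.
pose d := 2 * A + 2 * h.
have d0 : 0 <= d by rewrite addr_ge0// mulr_ge0.
have half0 n : 0 <= 2^-1 ^+ n :> R by rewrite exprn_ge0.
have dU n i t x : `|U n.+1 i t x - U n i t x| <= d * 2^-1 ^+ n.
  elim: n i t x => [|n IH] i t x.
    by rewrite subr0 expr0 mulr1; apply: le_trans ((bU 1%N).2 i t x) (wM t).
  rewrite exprSr mulrA.
  exact: (Phi_contraction (bU n.+1) (bU n) (mulr_ge0 d0 (half0 n)) IH).
(* The limit is taken at every point separately, with a rate independent of the point. *)
have L i t x := geometric_limit (fun n => dU n i t x).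
pose u i t x := sval (cid2 (L i t x)).
have cu i t x : U n i t x @[n --> \oo] --> u i t x by rewrite /u; case: cid2.
have eu i t x n : `|u i t x - U n i t x| <= 2 * d * 2^-1 ^+ n by rewrite /u; case: cid2.
have bu : ball u.
  split=> [i|i t x].
    apply: (@measurable_fun_cvg _ _ _ _ (fun n (z : R * R3 R) => U n i z.1 z.2)).
      by move=> n; exact: (bU n).1.
    by move=> z _; exact: cu.
  apply: (@ler_half_pow _ _ _ (2 * d)) => n.
  rewrite (_ : u i t x = U n i t x + (u i t x - U n i t x)); last by ring.
  by apply: le_trans (ler_normD _ _) _; apply: lerD; [exact: (bU n).2|exact: eu].
exists u; split; first exact: bu.1.
  by move=> i t x; exact: le_trans (bu.2 i t x) (wM t).
move=> i t x tT; rewrite -/(quad u) -PhiE//.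
apply/eqP; rewrite -subr_eq0 -normr_le0.
apply: (@ler_half_pow _ _ _ (2 * d)) => n; rewrite add0r.
have := Phi_contraction (bU n) bu _ (fun i t x =>
  _ : `|U n i t x - u i t x| <= 2 * d * 2^-1 ^+ n).
move=> /(_ _ _ i t x) H.
(* As [U n.+1] is [Phi (U n)], the second term is controlled by the contraction; both are
   O(2^-n). *)
rewrite (_ : _ - _ = (u i t x - U n.+1 i t x) + (U n.+1 i t x - Phi u i t x));
  last by ring.
apply: le_trans (ler_normD _ _) _.
apply: (@le_trans _ _ (2 * d * 2^-1 ^+ n.+1 + 2 * d * 2^-1 ^+ n * 2^-1)); last first.
  by rewrite exprSr; lra.
apply: lerD; first exact: eu.
apply: H; first by rewrite !mulr_ge0// exprn_ge0.
by move=> i' t' x'; rewrite distrC eu.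
Qed.

End picard.

(** * Large viscosity in the first variable *)

Section essential_bounds.
Context d (T : measurableType d) (R : realType) (m : {measure set T -> \bar R}).

Lemma ae_imply2 (P Q S : T -> Prop) : (forall x, P x -> Q x -> S x) ->
  {ae m, forall x, P x} -> {ae m, forall x, Q x} -> {ae m, forall x, S x}.
Proof. by move=> PQS; apply: filterS2. Qed.

Lemma Lfun_oo_ae_bounded (f : T -> R) : f \in Lfun m +oo%E ->
  measurable_fun setT f /\ exists2 A : R, 0 <= A & {ae m, forall x, `|f x| <= A}.
Proof.
move=> /andP[/[!inE] mf fn]; split => //.
move: fn; rewrite /= /finite_norm unlock.
(* If the whole space is null, the norm is 0 by convention and every property holds almost
   everywhere. *)
case: ifPn => [m0 fin|m0 _]; last first.
  exists 0 => //; exists setT; split => //.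
  by apply/eqP; rewrite eq_le measure_ge0 andbT leNgt.
have H := ess_sup_ge m (abse \o (EFin \o f)).
exists `|fine (ess_sup m (abse \o (EFin \o f)))|; first exact: normr_ge0.
apply: filterS H => x /=; move: fin.
case: (ess_sup _ _) => [r|//|] _ //=.
by rewrite lee_fin => /le_trans; apply; exact: ler_norm.
Qed.

Lemma Lnorm_oo_le (f : T -> R) (M : R) : 0 <= M -> (forall x, `|f x| <= M) ->
  ('N[m]_+oo[EFin \o f] <= M%:E)%E.
Proof.
move=> M0 fM; rewrite unlock; case: ifP => _; last by rewrite lee_fin.
by apply/ess_supP; apply: aeW => x; rewrite /= lee_fin.
Qed.

End essential_bounds.

Section free_evolution.
Context {R : realType}.

(** The datum is bounded by [A] only almost everywhere, whereas the iteration needs bounds at every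
    point. Truncation at time 0 changes [heat] on a null set; at positive times convolution already
    gives bounds everywhere. *)
Definition free_evolution (nu : R3 R) (A : R) (f : R3 R -> R) (t : R) (x : R3 R) : R :=
  if t == 0 then (if `|f x| <= A then f x else 0)
  else convolution (inv_fourier (heat_symbol nu t) (cst 0)) f x.

Lemma free_evolutionE (nu : R3 R) A f t x : t != 0 -> free_evolution nu A f t x =
  heat nu t f x.
Proof. by move=> /negbTE t0; rewrite /free_evolution /heat t0. Qed.

Lemma joint_measurable_free_evolution (nu : R3 R) A f : measurable_fun setT f ->
  joint_measurable (free_evolution nu A f).
Proof.
move=> mf; rewrite /joint_measurable /free_evolution.
have mf2 : measurable_fun setT (fun z : R * R3 R => f z.2).
  exact: measurable_fun_comp_snd.
have m0 : measurable_fun setT (fun z : R * R3 R => z.1) by mfun.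
apply: measurable_fun_ifT.
- exact: measurable_fun_eqr.
- apply: measurable_fun_ifT => //; apply: measurable_fun_ler => //.
  exact: (measurableT_comp (@normr_measurable R setT) mf2).
apply: (@measurable_Rintegral_param _ _ _ _ _ space_measure
  (fun z : (R * R3 R) * R3 R =>
     inv_fourier (heat_symbol nu z.1.1) (cst 0) (z.1.2 - z.2) * f z.2)).
apply: measurable_funM; last exact: measurable_fun_comp_snd.
by apply: measurable_fun_heat_kernel; mfun.
Qed.

Lemma normr_coord3_le_enorm (x : R3 R) i : `|coord3 i x| <= enorm x.
Proof.
rewrite /enorm -(@ler_pXn2r _ 2)// ?nnegrE ?sqrtr_ge0//.
have dot0 : forall j, 0 <= coord3 j x * coord3 j x by move=> j; exact: sqr_ge0.
rewrite sqr_sqrtr; last by apply: sumr_ge0.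
by rewrite real_normK ?num_real// /dot (bigD1 i)//= expr2 lerDl sumr_ge0.
Qed.

(* Spreading in the first variable makes the free evolution small at all times
   [t >= e], uniformly, as [nu_1] grows. *)
Lemma free_evolution_le (f : R3 R -> R) (nu2 nu3 A : R) :
  0 < nu3 -> nu3 <= nu2 -> measurable_fun setT f -> 0 <= A ->
  {ae mu3, forall x, `|f x| <= A} ->
  (forall c : R, 0 < c -> exists M : R,
    {ae mu3, forall x, M <= enorm x -> `|f x| <= c}) ->
  exists2 B : R, A <= B & forall h e : R, 0 < h -> 0 < e -> exists N : R,
    forall nu1, N <= nu1 -> forall t x, 0 <= t ->
    `|free_evolution (nu1, nu2, nu3) A f t x| <= B * (t < e)%R%:R + h.
Proof.
move=> nu30 nu32 mf A0 fA decay.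
have [C C0 HC] := heat_le (R := R).
(* [C * A] covers positive times and [A] covers [t = 0]. *)
exists ((C + 1) * A); first by rewrite mulrDl mul1r lerDr mulr_ge0.
move=> h e h0 e0.
(* Chosen so that [C * c <= h / 2]: the tail of the datum accounts for half of [h]. *)
pose c := h / (2 * C + 1).
have C21 : 0 < 2 * C + 1 by rewrite ltr_wpDl// mulr_ge0.
have c0 : 0 < c by rewrite divr_gt0.
have [M0 fM0] := decay c c0.
pose M := `|M0|.
have fM : {ae mu3, forall y, `|f y| <= c + A * (`|coord3 0 y| <= M)%R%:R}.
  apply: (ae_imply2 _ fA fM0) => y fyA fyc.
  have [yM|My] := leP `|coord3 0 y| M.
    by rewrite mulr1; apply: le_trans fyA _; rewrite lerDr ltW.
  rewrite mulr0 addr0; apply: fyc; apply: le_trans (ler_norm _) _.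
  exact: le_trans (ltW My) (normr_coord3_le_enorm _ _).
(* Once sqrt(t nu1) is at least [D], the strip accounts for at most the other half of [h]; adding 1
   keeps [D] positive. *)
pose D := 2 * (C * (A * M)) / h + 1.
have CA := mulr_ge0 C0 A0.
have M_ge0 : 0 <= M := normr_ge0 _.
have CAM : 0 <= C * (A * M) by rewrite !mulr_ge0.
have D0 : 0 < D by rewrite ltr_wpDl// divr_ge0 ?(ltW h0)// mulr_ge0.
(* For [t >= e] the condition [nu1 >= D ^+ 2 / e] gives sqrt(t nu1) >= D. *)
exists (Num.max nu2 (D ^+ 2 / e)) => nu1; rewrite ge_max => /andP[nu21 De] t x t0.
have nuge i : nu3 <= coord3 i (nu1, nu2, nu3).
  by move: i; apply: ord3_ind => //; rewrite /coord3/=; exact: le_trans nu21.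
have [->|tn0] := eqVneq t 0.
  rewrite /free_evolution eqxx e0 mulr1; case: ifP => [fxA|_].
    by lra.
  by rewrite normr0; lra.
have {}t0 : 0 < t by rewrite lt_neqAle eq_sym tn0.
rewrite free_evolutionE//; have [te|et] := ltP t e.
  rewrite mulr1; apply: (@le_trans _ _ (C * A)); last first.
    by lra.
  have := HC (nu1, nu2, nu3) t nu3 f A 0 0 x t0 nu30 nuge mf A0 (lexx 0) (lexx 0).
  rewrite !mul0r addr0; apply.
  by apply: (ae_imply2 _ fA fA) => y yA _; rewrite mul0r addr0.
rewrite mulr0 add0r.
apply: le_trans (HC (nu1, nu2, nu3) t nu3 f c A M x t0 nu30 nuge mf (ltW c0) A0
  (normr_ge0 _) fM) _.
have nu1_ge0 : 0 <= nu1 by exact: le_trans (ltW nu30) (le_trans nu32 nu21).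
have DS : D <= Num.sqrt (t * coord3 0 (nu1, nu2, nu3)).
  rewrite -(ger0_norm (ltW D0)) -sqrtr_sqr ler_wsqrtr//= /coord3/=.
  move: De; rewrite ler_pdivrMr// => /le_trans; apply.
  by rewrite mulrC ler_wpM2r.
have h1 : C * c <= h / 2.
  rewrite /c mulrA ler_pdivrMr//; have := mulr_ge0 C0 (ltW h0); lra.
have h2 : C * (A * M * (Num.sqrt (t * coord3 0 (nu1, nu2, nu3)))^-1) <= h / 2.
  rewrite mulrA ler_pdivrMr; last exact: lt_le_trans D0 DS.
  apply: (@le_trans _ _ (h / 2 * D));
    last by apply: ler_wpM2l => //; rewrite divr_ge0// ltW.
  rewrite /D mulrDr mulr1 (_ : h / 2 * _ = C * (A * M)); last by field; rewrite gt_eqF.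
  by rewrite lerDl divr_ge0// ltW.
by rewrite mulrDr; lra.
Qed.

End free_evolution.

(** [h] is chosen first, against [K * Num.sqrt T]: the long-time term is quadratic in [h], so a
    fraction of [h] absorbs it. Then [e = r ^+ 2] is chosen against [K * A ^+ 2] and [h]. Since
    [1 <= A], the bound on [K * A ^+ 2 * r] also controls [K * A * r]. *)
Lemma small_parameters (R : realType) (K A T : R) : 0 <= K -> 1 <= A -> 0 < T ->
  exists h e : R, [/\ 0 < h, h <= 1, 0 < e,
    K * (2 * (16 * A ^+ 2) * Num.sqrt e + 2 * (4 * h ^+ 2) * Num.sqrt T) <= h &
    K * (2 * (4 * A) * Num.sqrt e + 2 * (4 * h) * Num.sqrt T) <= 2^-1].
Proof.
move=> K0 A1 T0; have A0 : 0 <= A by exact: le_trans A1.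
pose S := K * Num.sqrt T.
have S0 : 0 <= S by rewrite mulr_ge0 ?sqrtr_ge0.
pose h := (32 * S + 1)^-1.
have den0 : 0 < 32 * S + 1 by lra.
have h0 : 0 < h by rewrite invr_gt0.
have Sh : 32 * (S * h) <= 1.
  have : (32 * S + 1) * h = 1 by rewrite divff// gt_eqF.
  lra.
have h1 : h <= 1 by rewrite invf_le1//; lra.
have KA0 : 0 <= K * A ^+ 2 by rewrite mulr_ge0 ?sqr_ge0.
pose r := h / (64 * (K * A ^+ 2) + 1).
have den1 : 0 < 64 * (K * A ^+ 2) + 1 by lra.
have r0 : 0 < r by rewrite divr_gt0.
have KAr : 64 * (K * A ^+ 2 * r) <= h.
  have : (64 * (K * A ^+ 2) + 1) * r = h by rewrite mulrC divfK// gt_eqF.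
  lra.
exists h, (r ^+ 2); split => //; first by rewrite exprn_gt0.
  rewrite sqrtr_sqr ger0_norm ?(ltW r0)//.
  rewrite (_ : K * _ = 32 * (K * A ^+ 2 * r) + 8 * (S * h) * h); last first.
    by rewrite /S; ring.
  have : 32 * (S * h) * h <= 1 * h by rewrite ler_wpM2r// ltW.
  lra.
rewrite sqrtr_sqr ger0_norm ?(ltW r0)//.
rewrite (_ : K * _ = 8 * (K * A * r) + 8 * (S * h)); last by rewrite /S; ring.
have : K * A * r <= K * A ^+ 2 * r.
  by rewrite ler_wpM2r ?(ltW r0)// ler_wpM2l// expr2 ler_peMl.
lra.
Qed.

Lemma strong_solution_exists (R : realType) (u0 : R3 R -> R3 R) (nu2 nu3 T : R) :
  Linfty_field u0 -> vanishes_at_infinity u0 -> 0 < nu3 -> nu3 <= nu2 -> 0 < T ->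
  exists N : R, forall nu1, N <= nu1 ->
    exists u, strong_solution (nu1, nu2, nu3) u0 T u.
Proof.
move=> u0L u0decay nu30 nu32 T0.
pose f i : R3 R -> R := coord3 i \o u0.
have fL i := Lfun_oo_ae_bounded (u0L i).
have mf i : measurable_fun setT (f i) := (fL i).1.
have [A1 A10 fA] : exists2 A1 : R, 0 <= A1 & forall i,
  {ae mu3, forall x, `|f i x| <= A1}.
  have [a a0 ha] := (fL 0).2; have [b b0 hb] := (fL 1).2; have [c c0 hc] := (fL 2).2.
  exists (a + b + c); first by rewrite !addr_ge0.
  apply: ord3_ind.
  - by apply: (ae_imply2 _ ha ha) => x xa _; apply: le_trans xa _; lra.
  - by apply: (ae_imply2 _ hb hb) => x xa _; apply: le_trans xa _; lra.
  - by apply: (ae_imply2 _ hc hc) => x xa _; apply: le_trans xa _; lra.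
have decay i (c : R) : 0 < c ->
    exists M : R, {ae mu3, forall x, M <= enorm x -> `|f i x| <= c}.
  move=> /u0decay[M HM]; exists M; apply: (ae_imply2 _ HM HM) => x Hx _ Mx.
  exact: le_trans (normr_coord3_le_enorm _ _) (Hx Mx).
have [C0 C00 kernel] := leray_kernel_le (R := R).
(* The smallest viscosity is absorbed in the constant, which leaves the pure time singularity
   expected by the Picard section and no dependence on nu1. *)
pose C := C0 * (Num.sqrt nu3)^-1.
have C_ge0 : 0 <= C by rewrite mulr_ge0// invr_ge0 sqrtr_ge0.
(* [B] is fixed before [h] and [e], and only the threshold on nu1 depends on them. The bound
   [1 <= B] together with [h <= 1] gives the [h <= A] of the fixed point. *)
have [B [B_ge HB]] : exists B : R, 1 <= B /\ forall h e : R, 0 < h -> 0 < e ->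
    exists N : R, forall nu1, N <= nu1 -> forall i t x, 0 <= t ->
    `|free_evolution (nu1, nu2, nu3) A1 (f i) t x| <= B * (t < e)%R%:R + h.
  have F i := free_evolution_le nu30 nu32 (mf i) A10 (fA i) (decay i).
  have [a a1 ha] := F 0; have [b b1 hb] := F 1; have [c c1 hc] := F 2.
  exists (a + b + c + 1); split; first by lra.
  move=> h e h0 e0; have [Na HNa] := ha h e h0 e0.
  have [Nb HNb] := hb h e h0 e0; have [Nc HNc] := hc h e h0 e0.
  exists (Num.max Na (Num.max Nb Nc)) => nu1.
  rewrite !ge_max => /and3P[na nb nc] i t x t0; move: i.
  have I0 : 0 <= (t < e)%R%:R :> R by [].
  apply: ord3_ind.
  - apply: le_trans (HNa nu1 na t x t0) _; rewrite lerD2r ler_wpM2r//; lra.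
  - apply: le_trans (HNb nu1 nb t x t0) _; rewrite lerD2r ler_wpM2r//; lra.
  - apply: le_trans (HNc nu1 nc t x t0) _; rewrite lerD2r ler_wpM2r//; lra.
have [h [e [h0 h1 e0 small1 small2]]] := small_parameters
  (mulr_ge0 (ler0n R 9) C_ge0) B_ge T0.
have [N HN] := HB h e h0 e0.
exists (Num.max N nu2) => nu1; rewrite ge_max => /andP[nu1N nu12].
pose nu : R3 R := (nu1, nu2, nu3).
have nuge i : nu3 <= coord3 i nu.
  by move: i; apply: ord3_ind => //; rewrite /coord3/=; exact: le_trans nu12.
have kernel_nu t i j k x : 0 < t ->
    (\int[mu3]_y `|heat_leray_div_kernel nu t i j k (x - y)|%:E <=
     (C * (Num.sqrt t)^-1)%:E)%E.
  move=> t0; apply: le_trans (kernel nu t nu3 i j k t0 nu30 nuge x) _.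
  by rewrite sqrtrM ?(ltW t0)// invfM /C lee_fin -mulrA (mulrC (Num.sqrt t)^-1).
have [u [mu uB uE]] := picard_fixed_point C_ge0 kernel_nu (ltW e0) (ltW h0)
  (le_trans h1 B_ge)
  (fun i => joint_measurable_free_evolution nu A1 (mf i))
  (fun i t x (tT : 0 <= t < T) => HN nu1 nu1N i t x (let: conj t0 _ := andP tT in t0))
  small1 small2.
pose U (t : R) (x : R3 R) : R3 R := (u 0 t x, u 1 t x, u 2 t x).
have UE i t x : coord3 i (U t x) = u i t x by move: i; apply: ord3_ind.
exists U; split.
  split.
    apply: measurable_funTS; apply: measurable_fun_R3 => i.
    rewrite (_ : (fun z => _) = fun z : R * R3 R => u i z.1 z.2); first exact: mu.
    by apply/funext => z; exact: UE.
  move=> T' _; exists (2 * B + 2 * h); apply: aeW => t _ i.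
  apply: Lnorm_oo_le; first by lra.
  by move=> x; rewrite /= UE; exact: uB.
move=> t tT; have /andP[t0 _] := tT.
(* Only at [t = 0] does the truncation make this an almost everywhere statement. *)
have FE : {ae mu3, forall x i, free_evolution nu A1 (f i) t x = heat nu t (f i) x}.
  have [->|tn0] := eqVneq t 0; last by apply: aeW => x i; exact: free_evolutionE.
  have E i : {ae mu3, forall x, free_evolution nu A1 (f i) 0 x = heat nu 0 (f i) x}.
    apply: (ae_imply2 _ (fA i) (fA i)) => x xA _.
    by rewrite /free_evolution /heat eqxx xA.
  have E01 : {ae mu3, forall x, free_evolution nu A1 (f 0) 0 x = heat nu 0 (f 0) x /\
      free_evolution nu A1 (f 1) 0 x = heat nu 0 (f 1) x}.
    exact: (ae_imply2 _ (E 0) (E 1)).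
  by apply: (ae_imply2 _ E01 (E 2)) => x [x0 x1] x2; apply: ord3_ind.
apply: (ae_imply2 _ FE FE) => x Fx _ i.
rewrite UE (uE i t x tT) (Fx i); congr (_ - _).
apply: eq_Rintegral => s _; congr heat_leray_div.
by apply/funext => j; apply/funext => k; apply/funext => y; rewrite /otimes !UE.
Qed.

Theorem theorem1p2 (R : realType) (u0 : R3 R -> R3 R) (nu2 nu3 : R)
  (u0_Linfty : Linfty_field u0)
  (u0_div_free : div_free u0)
  (u0_decay : vanishes_at_infinity u0)
  (nu3_gt0 : 0 < nu3) (nu3_le_nu2 : nu3 <= nu2) :
  lifespan (nu1, nu2, nu3) u0 @[nu1 --> +oo] --> +oo%E.
Proof.
(* The lifespan being a supremum of existence times, a solution on a horizon [|B| + 1], positive and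
   above [B], is enough. *)
apply/cvgeyPge => B; have T0 : 0 < `|B| + 1 by rewrite ltr_wpDl.
have [N HN] := strong_solution_exists u0_Linfty u0_decay nu3_gt0 nu3_le_nu2 T0.
near=> nu1.
apply: (@le_trans _ _ (`|B| + 1)%:E).
  by rewrite lee_fin; apply: le_trans (ler_norm B) _; rewrite lerDl.
apply: ereal_sup_ubound => /=; exists (`|B| + 1) => //; split => //.
by apply: HN; near: nu1; apply: nbhs_pinfty_ge; rewrite num_real.
Unshelve. all: by end_near.
Qed.
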